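(* Let $n\in\mathbb N$ and let $\hat A\in\mathrm{Extr}(\mathcal A^n_+)$ with $\langle n|\hat A|n\rangle>0$. Then there exists $t_0>0$ such that for all $t\ge t_0$, $\mathcal V^{\mathrm{norm}}_t[\hat A]\in\mathrm{Extr}(\mathcal D^n_+)$ and $\mathcal V^{\mathrm{norm}}_t[\hat A]\in\mathrm{Extr}(\mathcal D_+)$.
   Context: Let $\mathcal H=L^2(\mathbb R)$ with annihilation operator $\hat a$, number operator $\hat n=\hat a^\dagger\hat a$, Fock basis $\{|k\rangle\}$, $\hat D(\alpha)=\exp(\alpha\hat a^\dagger-\alpha^*\hat a)$, $\hat\Pi(\alpha)=\hat D(\alpha)(-1)^{\hat n}\hat D(\alpha)^\dagger$. The Wigner function of a trace-class $\hat A$ is $W_{\hat A}(\alpha)=\frac{2}{\pi}\mathrm{Tr}[\hat A\hat\Pi(\alpha)]$. A quasi-state is a Hermitian trace-class unit-trace operator; a state is a positive semi-definite quasi-state. With $\hat P_n=\sum_{k=0}^n|k\rangle\langle k|$: $\mathcal A^n_+$ is the set of quasi-states $\hat A$ with $\hat P_n\hat A\hat P_n=\hat A$ and $W_{\hat A}\ge0$ everywhere; $\mathcal D_+$ is the set of states with non-negative Wigner function; $\mathcal D^n_+=\mathcal D_+\cap\{\hat\rho:\hat P_n\hat\rho\hat P_n=\hat\rho\}$. $\mathrm{Extr}(\mathcal C)$ denotes the set of extreme points of a convex set $\mathcal C$. For $t>0$ and a trace-class operator $\hat A$ with $\hat P_N\hat A\hat P_N=\hat A$ for some $N$, the Vertigo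 map is $\mathcal V_t[\hat A]=\sum_{k\ge0}\frac{(t-1)^k}{k!}\,t^{\hat n/2}\hat a^k\hat A\hat a^{\dagger k}t^{\hat n/2}$ (a finite sum), equivalently characterized by $W_{\mathcal V_t[\hat A]}(\alpha)=W_{\hat A}(\sqrt t\,\alpha)\,e^{2(t-1)|\alpha|^2}$; and $\mathcal V^{\mathrm{norm}}_t[\hat A]=\mathcal V_t[\hat A]/\mathrm{Tr}\,\mathcal V_t[\hat A]$ whenever this trace is non-zero. *)

(* Defs.v *)
(* Stdlib reals + Coquelicot complex numbers (Complex.C) and series.
   Operators on H = L^2(R) are represented by their (infinite) matrices in the
   Fock basis {|k>}: an operator is  A : nat -> nat -> C  with  A i j = <i|A|j>. *)
From Stdlib Require Import Reals.
From Coquelicot Require Import Coquelicot.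
Open Scope R_scope.

Definition op := nat -> nat -> C.

(* Complex series value: sum of real parts + i * sum of imaginary parts
   (equals the complex limit whenever the complex series converges). *)
Definition CSeries (a : nat -> C) : C :=
  (Series (fun k => Re (a k)), Series (fun k => Im (a k))).

(* the generator  alpha a^dagger - conj(alpha) a  in the Fock basis:
   <i|a^dagger|j> = sqrt(j+1) [i = j+1],  <i|a|j> = sqrt j [i+1 = j]. *)
Definition gen (alpha : C) (i j : nat) : C :=
  ((if Nat.eqb i (S j) then alpha * RtoC (sqrt (INR (S j))) else 0)
   - (if Nat.eqb (S i) j then Cconj alpha * RtoC (sqrt (INR j)) else 0))%C.

(* matrix entries of the p-th power of the generator (row i is supported on
   columns i-1, i+1, so the matrix product is a finite sum over l <= i+1) *)
Fixpoint genpow (alpha : C) (p : nat) (i j : nat) : C :=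
  match p with
  | O => if Nat.eqb i j then 1%C else 0%C
  | S p' => sum_n (fun l => (gen alpha i l * genpow alpha p' l j)%C) (S i)
  end.

(* <m| D(alpha) |n> = sum_p <m|(alpha a^dag - conj(alpha) a)^p|n> / p!
   (Fock states are analytic vectors of the generator). *)
Definition disp (alpha : C) (m n : nat) : C :=
  CSeries (fun p => (genpow alpha p m n / RtoC (INR (Factorial.fact p)))%C).

(* <j| Pi(alpha) |k> = sum_l <j|D|l> (-1)^l <l|D^dagger|k> *)
Definition dparity (alpha : C) (j k : nat) : C :=
  CSeries (fun l => (disp alpha j l * RtoC ((-1) ^ l) * Cconj (disp alpha k l))%C).

(* W_A(alpha) = 2/pi Tr[A Pi(alpha)] = 2/pi sum_j sum_k <j|A|k><k|Pi|j> *)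
Definition wigner (A : op) (alpha : C) : C :=
  (RtoC (2 / PI) * CSeries (fun j => CSeries (fun k => A j k * dparity alpha k j)))%C.

Definition wigner_nonneg (A : op) : Prop :=
  forall alpha : C, 0 <= Re (wigner A alpha).

Definition hermitian (A : op) : Prop := forall i j, A j i = Cconj (A i j).

Definition l2 (x : nat -> C) : Prop := ex_series (fun i => Cmod (x i) ^ 2).
Definition l2norm (x : nat -> C) : R := sqrt (Series (fun i => Cmod (x i) ^ 2)).

(* trace class = nuclear: A = sum_k |u_k><v_k| with sum_k ||u_k|| ||v_k|| < oo *)
Definition trace_class (A : op) : Prop :=
  exists u v : nat -> nat -> C,
    (forall k, l2 (u k)) /\ (forall k, l2 (v k)) /\
    ex_series (fun k => l2norm (u k) * l2norm (v k)) /\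
    forall i j, is_series (fun k => (u k i * Cconj (v k j))%C) (A i j).

Definition op_trace (A : op) : C := CSeries (fun i => A i i).

Definition quasi_state (A : op) : Prop :=
  hermitian A /\ trace_class A /\ is_series (fun i => A i i) (RtoC 1).

(* positive semi-definite: <x|A|x> >= 0 on the dense subspace of finitely
   supported vectors (equivalent to positivity for bounded A) *)
Definition psd (A : op) : Prop :=
  forall (N : nat) (x : nat -> C),
    0 <= Re (sum_n (fun i => sum_n (fun j => (Cconj (x i) * A i j * x j)%C) N) N).

Definition state (A : op) : Prop := quasi_state A /\ psd A.

Definition supported (n : nat) (A : op) : Prop :=
  forall i j, (n < i \/ n < j)%nat -> A i j = 0%C.

Definition An_plus (n : nat) (A : op) : Prop :=
  quasi_state A /\ supported n A /\ wigner_nonneg A.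

Definition D_plus (rho : op) : Prop := state rho /\ wigner_nonneg rho.

Definition Dn_plus (n : nat) (rho : op) : Prop := D_plus rho /\ supported n rho.

Definition comb (lam : R) (B1 B2 : op) : op :=
  fun i j => (RtoC lam * B1 i j + RtoC (1 - lam) * B2 i j)%C.

Definition extr (S : op -> Prop) (X : op) : Prop :=
  S X /\ forall (Y Z : op) (lam : R), S Y -> S Z -> 0 < lam < 1 ->
    (forall i j, X i j = comb lam Y Z i j) -> forall i j, Y i j = Z i j.

(* Vertigo map: V_t[A] = sum_k (t-1)^k/k! t^{n/2} a^k A a^{dag k} t^{n/2};
   <i|a^k A a^{dag k}|j> = sqrt((i+k)!/i!) sqrt((j+k)!/j!) A(i+k,j+k). *)
Definition vertigo (t : R) (A : op) : op := fun i j =>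
  (RtoC (sqrt t ^ i * sqrt t ^ j) *
   CSeries (fun k => RtoC ((t - 1) ^ k / INR (Factorial.fact k)
                           * sqrt (INR (Factorial.fact (i + k)) / INR (Factorial.fact i))
                           * sqrt (INR (Factorial.fact (j + k)) / INR (Factorial.fact j)))
                     * A (i + k)%nat (j + k)%nat))%C.

Definition vertigo_norm (t : R) (A : op) : op := fun i j =>
  (vertigo t A i j / op_trace (vertigo t A))%C.

(* Main.v *)
(* In the rescaled Fock matrix sqrt(i! j!) <i|A|j>, the displaced parity has
   generating function exp(-2|al|^2) exp(2 al x + 2 al^* y - x y), and V_t sums
   the entries (i+k, j+k) against t^((i+j)/2) (t-1)^k/k!; the binomial theorem
   then yields both W_{V_t A}(al) = W_A(sqrt t al) e^{2(t-1)|al|^2} and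
   V_{1/t} V_t = id. As t -> oo, V_t A is dominated by t^n times a positive
   diagonal matrix proportional to <n|A|n>, so it becomes positive. A convex
   decomposition of V_t A in the Wigner-positive states pulls back along
   V_{1/t} to a decomposition of A with Wigner-positive components, which the
   extremality of A forces to be multiples of A. Components of a positive
   decomposition of a finitely supported state have the same support, so
   nothing changes when the decomposition is taken in all of D_+. *)
Require Import Defs.
From Stdlib Require Import Reals Lra Lia Psatz Factorial FunctionalExtensionality.
From Coquelicot Require Import Coquelicot.
Open Scope R_scope.

(** * Complex sums and series *)

(** The generating function must be extracted from [disp], a power series in a generator whose
    entries carry square roots. Division by [sqrt (m! n!)] removes the roots. The commutators of [a]
    and [a^dag] with the generator are scalars, so ladder recursions hold for each single power and
    pass to the sums term by term; only vacuum entries are ever summed explicitly. The parity series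
    inherits [a Pi = 2 al Pi - Pi a], which in coefficients is the differential equation of the
    Gaussian. Since [Series] gives a value to every sequence, convergence is carried along with each
    value.

    Shifting a matrix down its diagonal with weights [x^k/k!] is dual to multiplying a generating
    function in [u, v] by [exp (x u v)], so such weights add. Both identities for V_t are instances:
    [(t-1) - t = -1] for the Wigner function, [(s-1) t + (t-1) = 0] with [s t = 1] for the inverse.

    Positivity is a matter of diagonal dominance after the rescaling, a congruence that does not
    affect positivity. Extremality enters only through two-sided perturbations [A + H], [A - H]. *)

Ltac Ceq := lazymatch goal with |- ?a = ?b => change (@eq C a b) end.
(** Equalities between sums are typed at the carrier of an algebraic structure; [Ceq] restores the
    type [C] that [ring] recognises. *)
Ltac cring := Ceq; ring.

Lemma csum_0 (a : nat -> C) : sum_n a 0 = a 0%nat.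
Proof. apply sum_O. Qed.

Lemma csum_S (a : nat -> C) n : sum_n a (S n) = (sum_n a n + a (S n))%C.
Proof. apply (sum_Sn a). Qed.

Lemma csum_Sl (a : nat -> C) n :
  sum_n a (S n) = (a 0%nat + sum_n (fun k => a (S k)) n)%C.
Proof.
  induction n as [|n IH].
  - now rewrite csum_S, !csum_0.
  - rewrite csum_S, IH, csum_S. cring.
Qed.

Lemma csum_plus (a b : nat -> C) n :
  sum_n (fun k => (a k + b k)%C) n = (sum_n a n + sum_n b n)%C.
Proof. apply (sum_n_plus a b). Qed.

Lemma csum_scal (c : C) (a : nat -> C) n :
  sum_n (fun k => (c * a k)%C) n = (c * sum_n a n)%C.
Proof. apply (sum_n_mult_l (K := C_Ring) c a). Qed.

Lemma csum_zero (a : nat -> C) n :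
  (forall k, (k <= n)%nat -> a k = RtoC 0) -> sum_n a n = RtoC 0.
Proof.
  induction n as [|n IH]; intros H.
  - rewrite csum_0. now apply H.
  - rewrite csum_S, IH, H by auto. cring.
Qed.

Lemma csum_single (a : nat -> C) i n :
  (i <= n)%nat -> (forall k, (k <= n)%nat -> k <> i -> a k = 0%C) ->
  sum_n a n = a i.
Proof.
  induction n as [|n IH]; intros Hi H.
  - rewrite csum_0. now replace i with 0%nat by lia.
  - rewrite csum_S. destruct (Nat.eq_dec i (S n)) as [->|Hne].
    + rewrite csum_zero by (intros k Hk; apply H; lia). cring.
    + rewrite IH, (H (S n)) by (intros; try apply H; lia). cring.
Qed.

Lemma csum_widen (a : nat -> C) n m :
  (n <= m)%nat -> (forall k, (n < k)%nat -> a k = 0%C) -> sum_n a m = sum_n a n.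
Proof.
  induction 1 as [|m Hm IH]; intros H; [reflexivity|].
  rewrite csum_S, IH, H by (auto; lia). cring.
Qed.

Lemma csum_conj (a : nat -> C) n :
  Cconj (sum_n a n) = sum_n (fun k => Cconj (a k)) n.
Proof.
  induction n as [|n IH].
  - now rewrite !csum_0.
  - rewrite !csum_S, <- IH. apply injective_projections; simpl; ring.
Qed.

Lemma csum_Re (a : nat -> C) n : Re (sum_n a n) = sum_n (fun k => Re (a k)) n.
Proof.
  induction n as [|n IH].
  - now rewrite csum_0, sum_O.
  - rewrite csum_S, sum_Sn, <- IH. reflexivity.
Qed.

Lemma csum_Im (a : nat -> C) n : Im (sum_n a n) = sum_n (fun k => Im (a k)) n.
Proof.
  induction n as [|n IH].
  - now rewrite csum_0, sum_O.
  - rewrite csum_S, sum_Sn, <- IH. reflexivity.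
Qed.

Lemma csum_Cmod (a : nat -> C) n : Cmod (sum_n a n) <= sum_n (fun k => Cmod (a k)) n.
Proof.
  induction n as [|n IH].
  - rewrite csum_0, sum_O. lra.
  - rewrite csum_S, sum_Sn. eapply Rle_trans; [apply Cmod_triangle|].
    now apply Rplus_le_compat_r.
Qed.

Lemma csum_shift (f : nat -> C) k n :
  (forall m, (n < m)%nat -> f m = 0%C) ->
  sum_n (fun i => f (i + k)%nat) n = sum_n (fun m => if (k <=? m)%nat then f m else RtoC 0) n.
Proof.
  revert f. induction k as [|k IH]; intros f Hf.
  - apply sum_n_ext; intros i. now rewrite Nat.add_0_r.
  - rewrite (sum_n_ext _ (fun i => (fun m => f (S m)) (i + k)%nat)).
    2:{ intros i. now replace (i + S k)%nat with (S (i + k)) by lia. }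
    rewrite (IH (fun m => f (S m))) by (intros; apply Hf; lia).
    transitivity (sum_n (fun m => if (S k <=? m)%nat then f m else RtoC 0) (S n)).
    + rewrite csum_Sl. symmetry. apply Cplus_0_l.
    + apply csum_widen; [lia|]. intros m Hm. rewrite (Hf m Hm).
      now destruct (S k <=? m)%nat.
Qed.

Lemma is_series_finite {K : AbsRing} {V : NormedModule K} (a : nat -> V) n :
  (forall k, (n < k)%nat -> a k = zero) -> is_series a (sum_n a n).
Proof.
  intros H. unfold is_series.
  apply (filterlim_ext_loc (fun _ => sum_n a n)); [|apply filterlim_const].
  exists n. intros m Hm. symmetry.
  induction Hm as [|m Hm IH]; [reflexivity|].
  rewrite sum_Sn, IH, H by lia. apply plus_zero_r.
Qed.

(** Convergence is recorded for real and imaginary parts separately, matching the two [Series]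
    inside [CSeries]. *)
Definition cseries (a : nat -> C) (l : C) : Prop :=
  is_series (fun k => Re (a k)) (Re l) /\ is_series (fun k => Im (a k)) (Im l).

Lemma cseries_value a l : cseries a l -> CSeries a = l.
Proof.
  intros [H1 H2]. unfold CSeries.
  rewrite (is_series_unique _ _ H1), (is_series_unique _ _ H2). now destruct l.
Qed.

Lemma cseries_ext a b l : (forall k, a k = b k) -> cseries a l -> cseries b l.
Proof.
  intros H [H1 H2]; split; [revert H1|revert H2]; apply is_series_ext;
    intros k; now rewrite H.
Qed.

Lemma cseries_plus a b la lb :
  cseries a la -> cseries b lb -> cseries (fun k => (a k + b k)%C) (la + lb)%C.
Proof.
  intros [H1 H2] [H3 H4]; split.
  - exact (is_series_plus _ _ _ _ H1 H3).
  - exact (is_series_plus _ _ _ _ H2 H4).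
Qed.

Lemma cseries_scal c a l : cseries a l -> cseries (fun k => (c * a k)%C) (c * l)%C.
Proof.
  intros [H1 H2]; split.
  - refine (is_series_minus _ _ _ _ (is_series_scal (Re c) _ _ H1)
              (is_series_scal (Im c) _ _ H2)).
  - refine (is_series_plus _ _ _ _ (is_series_scal (Re c) _ _ H2)
              (is_series_scal (Im c) _ _ H1)).
Qed.

Lemma cseries_conj a l : cseries a l -> cseries (fun k => Cconj (a k)) (Cconj l).
Proof.
  intros [H1 H2]; split.
  - exact H1.
  - exact (is_series_opp _ _ H2).
Qed.

(** Entries of index -1 are read as zero, so the ladder relations below need no separate boundary
    form. *)
Definition prev (f : nat -> C) (k : nat) : C :=
  match k with O => 0%C | S k' => f k' end.

Lemma cseries_prev a l : cseries a l -> cseries (prev a) l.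
Proof.
  intros [H1 H2]; split; apply is_series_decr_1;
    [refine (eq_ind _ (is_series _) H1 _ _)|refine (eq_ind _ (is_series _) H2 _ _)];
    unfold plus, opp; simpl; ring.
Qed.

Lemma cseries_finite (a : nat -> C) n :
  (forall k, (n < k)%nat -> a k = 0%C) -> cseries a (sum_n a n).
Proof.
  intros H; split; [rewrite csum_Re|rewrite csum_Im];
    apply (is_series_finite (V := R_NormedModule)); intros k Hk; now rewrite H.
Qed.

Lemma cseries_zero : cseries (fun _ => RtoC 0) (RtoC 0).
Proof.
  refine (eq_ind _ (cseries _) _ _ (csum_0 (fun _ => RtoC 0))).
  now apply cseries_finite.
Qed.

Lemma CSeries_finite (a : nat -> C) n :
  (forall k, (n < k)%nat -> a k = 0%C) -> CSeries a = sum_n a n.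
Proof. intros H. now apply cseries_value, cseries_finite. Qed.

(** * Matrix elements of the displacement operator *)

Lemma Cmult_cancel (c x y : C) : c <> RtoC 0 -> (c * x = c * y)%C -> x = y.
Proof.
  intros Hc H. replace x with (/ c * (c * x))%C by (now field).
  rewrite H. now field.
Qed.

Lemma Cminus_eq (x y : C) : (x - y = 0)%C -> x = y.
Proof. intros H. replace x with (x - y + y)%C by ring. rewrite H. ring. Qed.

Lemma RtoC_neq (x : R) : x <> 0 -> RtoC x <> RtoC 0.
Proof. intros H E. apply H. now apply RtoC_inj. Qed.

Definition Nc (k : nat) : C := RtoC (INR k).

Lemma Nc_S k : Nc (S k) = (Nc k + 1)%C.
Proof. unfold Nc. now rewrite S_INR, RtoC_plus. Qed.

Lemma Nc_0 : Nc 0 = RtoC 0.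
Proof. reflexivity. Qed.

Lemma Nc_S_neq k : Nc (S k) <> RtoC 0.
Proof. apply RtoC_neq, not_0_INR. lia. Qed.

Definition sqrt_fact (k : nat) : R := sqrt (INR (fact k)).

Lemma fact_pos k : 0 < INR (fact k).
Proof. apply lt_0_INR, lt_O_fact. Qed.

Lemma sqrt_fact_pos k : 0 < sqrt_fact k.
Proof. apply sqrt_lt_R0, fact_pos. Qed.

Lemma sqrt_fact_sqr k : sqrt_fact k * sqrt_fact k = INR (fact k).
Proof. apply sqrt_sqrt. left. apply fact_pos. Qed.

Lemma fact_S k : INR (fact (S k)) = INR (S k) * INR (fact k).
Proof. rewrite <- mult_INR. reflexivity. Qed.

Lemma sqrt_fact_S k : sqrt_fact (S k) = sqrt (INR (S k)) * sqrt_fact k.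
Proof. unfold sqrt_fact. rewrite fact_S. apply sqrt_mult; left; [apply lt_0_INR; lia|apply fact_pos]. Qed.

Lemma sqrt_S_sqrt_fact k : sqrt (INR (S k)) * sqrt_fact (S k) = INR (S k) * sqrt_fact k.
Proof.
  rewrite sqrt_fact_S, <- Rmult_assoc, sqrt_sqrt; [reflexivity|]. apply pos_INR.
Qed.

Lemma sqrt_factC_neq k : RtoC (sqrt_fact k) <> RtoC 0.
Proof. apply RtoC_neq. pose proof (sqrt_fact_pos k). lra. Qed.

Lemma factC_neq k : RtoC (INR (fact k)) <> RtoC 0.
Proof. apply RtoC_neq. pose proof (fact_pos k). lra. Qed.

Ltac solve_neq := repeat match goal with |- _ /\ _ => split end;
  first [apply sqrt_factC_neq | apply factC_neq | apply Nc_S_neq | apply RtoC_neq; lra].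

Lemma genpow_S al p m n :
  genpow al (S p) m n =
  (al * prev (fun i => RtoC (sqrt (INR (S i))) * genpow al p i n) m
   - Cconj al * (RtoC (sqrt (INR (S m))) * genpow al p (S m) n))%C.
Proof.
  change (genpow al (S p) m n) with
    (sum_n (fun l => (gen al m l * genpow al p l n)%C) (S m)).
  rewrite csum_S.
  assert (H1 : gen al m (S m) = (0 - Cconj al * RtoC (sqrt (INR (S m))))%C).
  { unfold gen. rewrite Nat.eqb_refl.
    now replace (Nat.eqb m (S (S m))) with false by (symmetry; apply Nat.eqb_neq; lia). }
  rewrite H1. destruct m as [|m].
  - rewrite csum_0. unfold gen at 1. simpl Nat.eqb. cbn [prev]. cring.
  - rewrite (csum_single _ m (S m)); [|lia|].
    + unfold gen. rewrite Nat.eqb_refl.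
      replace (Nat.eqb (S (S m)) m) with false by (symmetry; apply Nat.eqb_neq; lia).
      cbn [prev]. cring.
    + intros k Hk Hne. unfold gen.
      replace (Nat.eqb (S m) (S k)) with false by (symmetry; apply Nat.eqb_neq; lia).
      replace (Nat.eqb (S (S m)) k) with false by (symmetry; apply Nat.eqb_neq; lia).
      cring.
Qed.

(* [<m|(al a^dag - al^* a)^p|n>] divided by [p! sqrt (m! n!)], so that no square
   root enters the recursions. *)
Definition gcoef (al : C) (p m n : nat) : C :=
  (genpow al p m n / (RtoC (INR (fact p)) * RtoC (sqrt_fact m) * RtoC (sqrt_fact n)))%C.

Lemma genpow_gcoef al p m n :
  genpow al p m n = (RtoC (INR (fact p)) * RtoC (sqrt_fact m) * RtoC (sqrt_fact n) * gcoef al p m n)%C.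
Proof.
  unfold gcoef. field. solve_neq.
Qed.

Definition prev_power (f : nat -> nat -> nat -> C) p m n := prev (fun p' => f p' m n) p.
Definition prev_row (f : nat -> nat -> nat -> C) p m n := prev (fun m' => f p m' n) m.
Definition prev_col (f : nat -> nat -> nat -> C) p m n := prev (fun n' => f p m n') n.

Lemma gcoef_0 al m n :
  gcoef al 0 m n = if Nat.eqb m n then (/ RtoC (INR (fact m)))%C else RtoC 0.
Proof.
  unfold gcoef. simpl genpow. destruct (Nat.eqb_spec m n) as [->|H].
  - rewrite <- (sqrt_fact_sqr n), RtoC_mult. change (INR (fact 0)) with 1.
    field. solve_neq.
  - field. solve_neq.
Qed.

Lemma gcoef_S al p m n :
  (Nc (S p) * gcoef al (S p) m n =
   al * prev_row (gcoef al) p m n - Cconj al * (Nc (S m) * gcoef al p (S m) n))%C.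
Proof.
  apply (Cmult_cancel (RtoC (INR (fact p)) * RtoC (sqrt_fact m) * RtoC (sqrt_fact n))).
  { repeat apply Cmult_neq_0; try apply sqrt_factC_neq; apply factC_neq. }
  transitivity (genpow al (S p) m n).
  { rewrite genpow_gcoef, fact_S, RtoC_mult. unfold Nc. ring. }
  rewrite genpow_S, (genpow_gcoef al p (S m)).
  assert (E : (RtoC (sqrt (INR (S m))) * RtoC (sqrt_fact (S m)) = Nc (S m) * RtoC (sqrt_fact m))%C).
  { unfold Nc. now rewrite <- !RtoC_mult, sqrt_S_sqrt_fact. }
  assert (F : (prev (fun i => RtoC (sqrt (INR (S i))) * genpow al p i n) m =
    RtoC (INR (fact p)) * RtoC (sqrt_fact m) * RtoC (sqrt_fact n) * prev_row (gcoef al) p m n)%C).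
  { destruct m as [|m]; unfold prev_row; cbn [prev]; [ring|].
    rewrite genpow_gcoef, (sqrt_fact_S m), RtoC_mult. ring. }
  rewrite F.
  replace (RtoC (sqrt (INR (S m))) * (RtoC (INR (fact p)) * RtoC (sqrt_fact (S m)) * RtoC (sqrt_fact n) * gcoef al p (S m) n))%C
    with ((RtoC (sqrt (INR (S m))) * RtoC (sqrt_fact (S m))) * (RtoC (INR (fact p)) * RtoC (sqrt_fact n) * gcoef al p (S m) n))%C by ring.
  rewrite E. ring.
Qed.

(** With G the generator, [[a, G] = al] gives [a G^p = G^p a + p al G^(p-1)]; this is its matrix
    entry after the rescaling. *)
Lemma gcoef_lower_row al p : forall m n,
  (Nc (S m) * gcoef al p (S m) n = prev_col (gcoef al) p m n + al * prev_power (gcoef al) p m n)%C.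
Proof.
  induction p as [|p IH]; intros m n.
  - unfold prev_col, prev_power. cbn [prev]. rewrite gcoef_0. destruct n as [|n]; cbn [prev].
    + simpl Nat.eqb. cbn iota. ring.
    + rewrite gcoef_0. simpl Nat.eqb. destruct (Nat.eqb m n); [|ring].
      rewrite fact_S, RtoC_mult. unfold Nc. field.
      split; [apply factC_neq | apply (Nc_S_neq m)].
  - apply (Cmult_cancel (Nc (S p))); [apply Nc_S_neq|].
    (* After multiplication by [p + 1], [E1] and [E3] peel one generator off the power [p + 1], and
       [E5] does so for the power [p]. [E2] and [E4] are the induction hypothesis in rows [m + 1]
       and [m - 1]. *)
    pose proof (gcoef_S al p (S m) n) as E1.
    pose proof (IH (S m) n) as E2.
    assert (E3 : (Nc (S p) * prev_col (gcoef al) (S p) m n =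
      al * prev_col (prev_row (gcoef al)) p m n - Cconj al * (Nc (S m) * prev_col (gcoef al) p (S m) n))%C).
    { destruct n; [unfold prev_col; simpl; ring|]. apply gcoef_S. }
    assert (E4 : (Nc m * gcoef al p m n = prev_col (prev_row (gcoef al)) p m n + al * prev_power (prev_row (gcoef al)) p m n)%C).
    { destruct m; [|apply IH]. rewrite Nc_0. unfold prev_col, prev_power, prev_row. destruct n, p; simpl; ring. }
    assert (E5 : (Nc p * gcoef al p m n =
      al * prev_power (prev_row (gcoef al)) p m n - Cconj al * (Nc (S m) * prev_power (gcoef al) p (S m) n))%C).
    { destruct p; [unfold prev_power; rewrite Nc_0; simpl; ring|]. apply gcoef_S. }
    change (prev_row (gcoef al) p (S m) n) with (gcoef al p m n) in E1.
    change (prev_power (gcoef al) (S p) m n) with (gcoef al p m n).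
    apply Cminus_eq.
    transitivity (
      Nc (S m) * (Nc (S p) * gcoef al (S p) (S m) n)
      - Nc (S p) * prev_col (gcoef al) (S p) m n - (Nc p + 1) * (al * gcoef al p m n))%C.
    { rewrite <- (Nc_S p). ring. }
    rewrite E1, E2, E3, (Nc_S m), <- !(Nc_S m).
    transitivity (al * (Nc m * gcoef al p m n) - al * (Nc p * gcoef al p m n)
      - Nc (S m) * Cconj al * al * prev_power (gcoef al) p (S m) n - al * prev_col (prev_row (gcoef al)) p m n)%C.
    { rewrite (Nc_S m). ring. }
    rewrite E4, E5. ring.
Qed.

(** The adjoint ladder relation [G^p a^dag = a^dag G^p - p (conj al) G^(p-1)], from [[a^dag, G] =
    conj al]. *)
Lemma gcoef_lower_col al p : forall m n,
  (Nc (S n) * gcoef al p m (S n) = prev_row (gcoef al) p m n - Cconj al * prev_power (gcoef al) p m n)%C.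
Proof.
  induction p as [|p IH]; intros m n.
  - unfold prev_row, prev_power. cbn [prev]. rewrite gcoef_0. destruct m as [|m]; cbn [prev].
    + simpl Nat.eqb. cbn iota. ring.
    + rewrite gcoef_0. simpl Nat.eqb. destruct (Nat.eqb_spec m n) as [->|]; [|ring].
      rewrite fact_S, RtoC_mult. unfold Nc. field.
      split; [apply factC_neq | apply (Nc_S_neq n)].
  - apply (Cmult_cancel (Nc (S p))); [apply Nc_S_neq|].
    pose proof (gcoef_S al p m (S n)) as E1.
    assert (E2 : (Nc (S n) * prev_row (gcoef al) p m (S n) =
      prev_row (prev_row (gcoef al)) p m n - Cconj al * prev_power (prev_row (gcoef al)) p m n)%C).
    { destruct m; [|apply IH]. unfold prev_row, prev_power. destruct p; simpl; ring. }
    pose proof (IH (S m) n) as E3.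
    change (prev_row (gcoef al) p (S m) n) with (gcoef al p m n) in E3.
    assert (E4 : (Nc (S p) * prev_row (gcoef al) (S p) m n =
      al * prev_row (prev_row (gcoef al)) p m n - Cconj al * (Nc m * gcoef al p m n))%C).
    { destruct m; [unfold prev_row; rewrite Nc_0; simpl; ring|]. apply gcoef_S. }
    assert (E5 : (Nc p * gcoef al p m n =
      al * prev_power (prev_row (gcoef al)) p m n - Cconj al * (Nc (S m) * prev_power (gcoef al) p (S m) n))%C).
    { destruct p; [unfold prev_power; rewrite Nc_0; simpl; ring|]. apply gcoef_S. }
    change (prev_power (gcoef al) (S p) m n) with (gcoef al p m n).
    apply Cminus_eq.
    transitivity (
      Nc (S n) * (Nc (S p) * gcoef al (S p) m (S n))
      - Nc (S p) * prev_row (gcoef al) (S p) m n + (Nc p + 1) * (Cconj al * gcoef al p m n))%C.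
    { rewrite <- (Nc_S p). ring. }
    rewrite E1, E4.
    transitivity (al * (Nc (S n) * prev_row (gcoef al) p m (S n))
      - Cconj al * Nc (S m) * (Nc (S n) * gcoef al p (S m) (S n))
      - al * prev_row (prev_row (gcoef al)) p m n + Cconj al * (Nc m + 1) * gcoef al p m n
      + Cconj al * (Nc p * gcoef al p m n))%C.
    { ring. }
    rewrite E2, E3, E5, <- (Nc_S m). ring.
Qed.

(** Going from (0,0) to (1,0) and back costs two powers of the generator and the factor
    [-|al|^2 / (p+2)]. The even terms therefore form an exponential series, while the odd ones
    vanish. *)
Lemma gcoef_vacuum al k :
  gcoef al (2 * k) 0 0 = RtoC ((- (Cmod al ^ 2 / 2)) ^ k / INR (fact k)) /\
  gcoef al (2 * k + 1) 0 0 = RtoC 0.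
Proof.
  assert (step : forall p, (Nc (S (S p)) * gcoef al (S (S p)) 0 0 =
      - RtoC (Cmod al ^ 2) * gcoef al p 0 0)%C).
  { intros p. rewrite gcoef_S, gcoef_lower_row. unfold prev_row, prev_col, prev_power. cbn [prev].
    rewrite Cmod2_conj. ring. }
  induction k as [|k [IH1 IH2]].
  - split.
    + rewrite gcoef_0. simpl Nat.eqb. cbn iota. apply injective_projections; simpl; field; simpl; lra.
    + change (2 * 0 + 1)%nat with 1%nat. apply (Cmult_cancel (Nc 1)); [apply Nc_S_neq|].
      rewrite gcoef_S, gcoef_lower_row. unfold prev_row, prev_col, prev_power. cbn [prev]. ring.
  - replace (2 * S k)%nat with (S (S (2 * k))) by lia.
    replace (S (S (2 * k)) + 1)%nat with (S (S (2 * k + 1))) by lia.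
    split.
    + apply (Cmult_cancel (Nc (S (S (2 * k))))); [apply Nc_S_neq|].
      rewrite step, IH1. unfold Nc.
      rewrite <- RtoC_opp, <- !RtoC_mult. f_equal.
      replace (INR (S (S (2 * k)))) with (2 * INR (S k)).
      2:{ rewrite !S_INR, mult_INR. simpl. ring. }
      rewrite fact_S. simpl pow. field. split; [pose proof (fact_pos k); lra|].
      apply not_0_INR; lia.
    + apply (Cmult_cancel (Nc (S (S (2 * k + 1))))); [apply Nc_S_neq|].
      rewrite step, IH2. ring.
Qed.

Lemma exp_series x : is_series (fun k => x ^ k / INR (fact k)) (exp x).
Proof.
  generalize (is_exp_Reals x). apply is_series_ext. intros k.
  rewrite pow_n_pow. reflexivity.
Qed.

Lemma gcoef_vacuum_series al :
  cseries (fun p => gcoef al p 0 0) (RtoC (exp (- (Cmod al ^ 2 / 2)))).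
Proof.
  split.
  (* The series is read as a power series at the point 1, so that it splits into its even and odd
     parts; [1 * 0] is the odd one. *)
  - replace (Re _) with (exp (- (Cmod al ^ 2 / 2)) + 1 * 0) by (simpl; ring).
    apply (is_series_ext (fun k => scal (pow_n 1 k) (Re (gcoef al k 0 0)))).
    { intros k. rewrite pow_n_pow, pow1. apply Rmult_1_l. }
    apply (is_pseries_odd_even (fun k => Re (gcoef al k 0 0))).
    + generalize (exp_series (- (Cmod al ^ 2 / 2))). apply is_series_ext. intros k.
      rewrite (proj1 (gcoef_vacuum al k)).
      change (?a = scal _ ?c) with (a = (1 ^ 2) ^ k * c).
      rewrite (pow1 2), pow1. symmetry. apply Rmult_1_l.
    + generalize (proj1 cseries_zero). apply is_series_ext. intros k.
      rewrite (proj2 (gcoef_vacuum al k)). symmetry. apply Rmult_0_r.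
  - generalize (proj2 cseries_zero). apply is_series_ext. intros k.
    destruct (Nat.Even_or_Odd k) as [[q ->]|[q ->]].
    + now rewrite (proj1 (gcoef_vacuum al q)).
    + now rewrite (proj2 (gcoef_vacuum al q)).
Qed.

Definition dcoef (al : C) (m n : nat) : C := CSeries (fun p => gcoef al p m n).

Lemma Ndiv k x : (Nc (S k) * (/ Nc (S k) * x) = x)%C.
Proof. field. apply Nc_S_neq. Qed.

(** Convergence spreads from the vacuum entry, first along row 0 by the column relation, then down
    the rows by the row relation. *)
Lemma gcoef_series al m n : exists l, cseries (fun p => gcoef al p m n) l.
Proof.
  revert n. induction m as [|m IHm].
  - induction n as [|n [l Hl]]; [eexists; apply gcoef_vacuum_series|].
    exists (/ Nc (S n) * (- Cconj al * l))%C.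
    apply (cseries_ext (fun p => / Nc (S n) * (- Cconj al * prev (fun p => gcoef al p 0 n) p))%C).
    2:{ now do 2 apply cseries_scal; apply cseries_prev. }
    intros p. apply (Cmult_cancel (Nc (S n))); [apply Nc_S_neq|].
    rewrite Ndiv, gcoef_lower_col. unfold prev_row, prev_power. cbn [prev]. ring.
  - intros n.
    assert (Hp : exists l, cseries (fun p => prev_col (gcoef al) p m n) l).
    { destruct n; [exists (RtoC 0); apply cseries_zero|apply IHm]. }
    destruct Hp as [l1 H1], (IHm n) as [l2 H2].
    exists (/ Nc (S m) * (l1 + al * l2))%C.
    eapply cseries_ext;
      [|apply cseries_scal, cseries_plus; [exact H1|apply cseries_scal, cseries_prev; exact H2]].
    intros p. cbv beta. apply (Cmult_cancel (Nc (S m))); [apply Nc_S_neq|].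
    rewrite Ndiv, gcoef_lower_row. reflexivity.
Qed.

Lemma dcoef_series al m n : cseries (fun p => gcoef al p m n) (dcoef al m n).
Proof.
  destruct (gcoef_series al m n) as [l Hl]. unfold dcoef. now rewrite (cseries_value _ _ Hl).
Qed.

Lemma cseries_unique a l l' : cseries a l -> cseries a l' -> l = l'.
Proof. intros H H'. now rewrite <- (cseries_value _ _ H), (cseries_value _ _ H'). Qed.

Lemma dcoef_vacuum al : dcoef al 0 0 = RtoC (exp (- (Cmod al ^ 2 / 2))).
Proof. apply cseries_value, gcoef_vacuum_series. Qed.

(** The entrywise form of [a D = D a + al D]. *)
Lemma dcoef_lower_row al m n :
  (Nc (S m) * dcoef al (S m) n = prev (dcoef al m) n + al * dcoef al m n)%C.
Proof.
  apply (cseries_unique (fun p => Nc (S m) * gcoef al p (S m) n)%C).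
  - apply cseries_scal, dcoef_series.
  - eapply cseries_ext; [intros p; symmetry; apply gcoef_lower_row|].
    apply cseries_plus; [|apply cseries_scal, cseries_prev, dcoef_series].
    destruct n; [apply cseries_zero|apply dcoef_series].
Qed.

(** The entrywise form of [D a^dag = a^dag D - (conj al) D]. *)
Lemma dcoef_lower_col al m n :
  (Nc (S n) * dcoef al m (S n) = prev (fun i => dcoef al i n) m - Cconj al * dcoef al m n)%C.
Proof.
  apply (cseries_unique (fun p => Nc (S n) * gcoef al p m (S n))%C).
  - apply cseries_scal, dcoef_series.
  - apply (cseries_ext (fun p => prev_row (gcoef al) p m n + - Cconj al * prev_power (gcoef al) p m n)%C).
    { intros p. rewrite gcoef_lower_col. ring. }
    replace (_ - _)%C with (prev (fun i => dcoef al i n) m + - Cconj al * dcoef al m n)%C by ring.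
    apply cseries_plus; [|apply cseries_scal, cseries_prev, dcoef_series].
    destruct m; [apply cseries_zero|apply dcoef_series].
Qed.

Lemma disp_dcoef al m n : disp al m n = (RtoC (sqrt_fact m) * RtoC (sqrt_fact n) * dcoef al m n)%C.
Proof.
  apply cseries_value.
  apply (cseries_ext (fun p => RtoC (sqrt_fact m) * RtoC (sqrt_fact n) * gcoef al p m n)%C).
  { intros p. rewrite genpow_gcoef. field. apply factC_neq. }
  apply cseries_scal, dcoef_series.
Qed.

(** * Matrix elements of the displaced parity *)

(** The factorial collects the two factors [sqrt (l!)] that the two displacement entries release
    when they are written with [dcoef]. *)
Definition sign_fact (l : nat) : C := RtoC ((-1) ^ l * INR (fact l)).

Definition parterm (al : C) (j k l : nat) : C :=
  (sign_fact l * dcoef al j l * Cconj (dcoef al k l))%C.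

Lemma sign_fact_S l : sign_fact (S l) = (- Nc (S l) * sign_fact l)%C.
Proof.
  unfold sign_fact, Nc. rewrite fact_S, <- RtoC_opp, <- RtoC_mult. f_equal. simpl pow. ring.
Qed.

Lemma Cconj_Nc k : Cconj (Nc k) = Nc k.
Proof. apply injective_projections; simpl; ring. Qed.

Lemma Cconj_RtoC (x : R) : Cconj (RtoC x) = RtoC x.
Proof. apply injective_projections; simpl; ring. Qed.

Lemma Cconj_prev f k : Cconj (prev f k) = prev (fun i => Cconj (f i)) k.
Proof. destruct k; simpl; [apply Cconj_RtoC|reflexivity]. Qed.

(** Termwise form of [a Pi = 2 al Pi - Pi a]. Lowering the row of the first displacement produces
    [al] once; moving [a] past the parity flips its sign and shifts [l] by one, and the conjugated
    column relation produces the second [al]. *)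
Lemma parterm_S al j k l :
  (Nc (S j) * parterm al (S j) k l =
   al * parterm al j k l +
   prev (fun i => al * parterm al j k i - prev (fun k' => parterm al j k' i) k) l)%C.
Proof.
  assert (H : forall i, (al * parterm al j k i - prev (fun k' => parterm al j k' i) k =
            sign_fact (S i) * dcoef al j i * Cconj (dcoef al k (S i)))%C).
  { intros i. pose proof (f_equal Cconj (dcoef_lower_col al k i)) as E.
    rewrite Cmult_conj, Cconj_Nc, Cminus_conj, Cmult_conj, Cconj_conj, Cconj_prev in E.
    rewrite sign_fact_S.
    transitivity (- sign_fact i * dcoef al j i * (Nc (S i) * Cconj (dcoef al k (S i))))%C; [|ring].
    rewrite E. unfold parterm. destruct k; cbn [prev]; ring. }
  assert (H' : prev (fun i => al * parterm al j k i - prev (fun k' => parterm al j k' i) k)%C l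
    = (sign_fact l * prev (dcoef al j) l * Cconj (dcoef al k l))%C).
  { destruct l; cbn [prev]; [ring|apply H]. }
  rewrite H'. unfold parterm.
  transitivity (sign_fact l * (Nc (S j) * dcoef al (S j) l) * Cconj (dcoef al k l))%C; [ring|].
  rewrite dcoef_lower_row. ring.
Qed.

Lemma parterm_series_S al j k x y :
  cseries (parterm al j k) x ->
  cseries (fun l => prev (fun k' => parterm al j k' l) k) y ->
  cseries (parterm al (S j) k) (/ Nc (S j) * (2 * al * x - y))%C.
Proof.
  intros Hx Hy.
  apply (cseries_ext (fun l => / Nc (S j) * (Nc (S j) * parterm al (S j) k l))%C).
  { intros l. field. apply Nc_S_neq. }
  apply cseries_scal.
  eapply cseries_ext; [intros l; symmetry; apply parterm_S|].
  replace (2 * al * x - y)%C with (al * x + (al * x + - (1) * y))%C by ring.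
  apply cseries_plus; [now apply cseries_scal|].
  apply cseries_prev.
  apply (cseries_ext (fun l => al * parterm al j k l + - (1) * prev (fun k' => parterm al j k' l) k)%C).
  { intros l. ring. }
  apply cseries_plus; now apply cseries_scal.
Qed.

(** * Coefficients of the Gaussian generating function *)

Definition exp_coeff (x : R) (k : nat) : C := RtoC (x ^ k / INR (fact k)).

(** Coefficient of [x^j] in [x^s exp (a x)]. The guard gives 0 for [s > j], where the truncated
    subtraction [j - s] would give 1. *)
Definition taylor (a : C) (j s : nat) : C :=
  if (s <=? j)%nat then (a ^ (j - s) / RtoC (INR (fact (j - s))))%C else RtoC 0.

(* Coefficient of [x^j y^k] in [exp (c x y + a x + b y)]. *)
Definition gauss (c : R) (a b : C) (j k : nat) : C :=
  sum_n (fun s => (exp_coeff c s * taylor a j s * taylor b k s)%C) j.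

Lemma taylor_0 a j s : (j < s)%nat -> taylor a j s = RtoC 0.
Proof. intros H. unfold taylor. now rewrite (proj2 (Nat.leb_gt s j) H). Qed.

Lemma taylor_00 a : taylor a 0 0 = RtoC 1.
Proof. apply injective_projections; simpl; field. Qed.

Lemma taylor_SS a j s : taylor a (S j) (S s) = taylor a j s.
Proof. reflexivity. Qed.

Lemma taylor_add a j s i : taylor a (j + i) (s + i) = taylor a j s.
Proof.
  induction i as [|i IH]; [now rewrite !Nat.add_0_r|].
  now rewrite !Nat.add_succ_r, taylor_SS.
Qed.

Lemma taylor_S a j s : ((Nc (S j) - Nc s) * taylor a (S j) s = a * taylor a j s)%C.
Proof.
  destruct (Nat.le_gt_cases s j) as [H|H].
  - unfold taylor. rewrite (proj2 (Nat.leb_le s j)), (proj2 (Nat.leb_le s (S j))) by lia.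
    replace (S j - s)%nat with (S (j - s)) by lia.
    rewrite fact_S, RtoC_mult, Cpow_S.
    replace (Nc (S j) - Nc s)%C with (Nc (S (j - s))).
    + unfold Nc. field. split; [apply factC_neq|apply (Nc_S_neq (j - s))].
    + unfold Nc. rewrite <- RtoC_minus. f_equal. rewrite <- minus_INR by lia. f_equal. lia.
  - rewrite (taylor_0 a j) by lia. destruct (Nat.eq_dec s (S j)) as [->|].
    + ring.
    + rewrite taylor_0 by lia. ring.
Qed.

Lemma exp_coeff_S x k : (Nc (S k) * exp_coeff x (S k) = RtoC x * exp_coeff x k)%C.
Proof.
  unfold Nc, exp_coeff. rewrite <- !RtoC_mult. f_equal. rewrite fact_S. simpl pow.
  field. split; [pose proof (fact_pos k); lra|apply not_0_INR; lia].
Qed.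

Lemma gauss_widen c a b j k n :
  (j <= n)%nat ->
  gauss c a b j k = sum_n (fun s => (exp_coeff c s * taylor a j s * taylor b k s)%C) n.
Proof.
  intros H. symmetry. apply csum_widen; [exact H|].
  intros s Hs. rewrite taylor_0 by exact Hs. ring.
Qed.

(** The derivative in [x] of [exp (c x y + a x + b y)] is [(a + c y)] times it. With [c = -1] and
    [a = 2 al] this is the recursion obeyed by the parity entries. *)
Lemma gauss_S c a b j k :
  (Nc (S j) * gauss c a b (S j) k = a * gauss c a b j k + RtoC c * prev (gauss c a b j) k)%C.
Proof.
  unfold gauss at 1. rewrite <- csum_scal.
  rewrite (sum_n_ext _ (fun s => (a * (exp_coeff c s * taylor a j s * taylor b k s) +
    Nc s * exp_coeff c s * taylor a (S j) s * taylor b k s)%C)).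
  2:{ intros s. transitivity (exp_coeff c s * taylor b k s * ((Nc (S j) - Nc s) * taylor a (S j) s)
         + Nc s * exp_coeff c s * taylor a (S j) s * taylor b k s)%C; [cring|].
      rewrite taylor_S. cring. }
  rewrite csum_plus. f_equal.
  - rewrite csum_scal. f_equal. symmetry. apply gauss_widen. lia.
  - rewrite csum_Sl, Nc_0.
    destruct k as [|k]; cbn [prev].
    + rewrite csum_zero; [cring|]. intros s _. rewrite (taylor_0 b) by lia. cring.
    + unfold gauss. rewrite <- csum_scal.
      rewrite (sum_n_ext _ (fun s => (RtoC c * (exp_coeff c s * taylor a j s * taylor b k s))%C)); [cring|].
      intros s. rewrite !taylor_SS, exp_coeff_S. cring.
Qed.

Lemma exp_coeff_0 x : exp_coeff x 0 = RtoC 1.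
Proof. unfold exp_coeff. f_equal. simpl. field. Qed.

Lemma gauss_0l c a b k : gauss c a b 0 k = taylor b k 0.
Proof.
  unfold gauss. rewrite csum_0, exp_coeff_0, taylor_00. cring.
Qed.

Lemma gauss_0r c a b j : gauss c a b j 0 = taylor a j 0.
Proof.
  unfold gauss. rewrite (csum_single _ 0) by
    (intros; try lia; rewrite (taylor_0 b) by lia; ring).
  rewrite exp_coeff_0, taylor_00. cring.
Qed.

Lemma Cconj_taylor a j s : Cconj (taylor a j s) = taylor (Cconj a) j s.
Proof.
  unfold taylor. destruct (s <=? j)%nat; [|apply Cconj_RtoC].
  unfold Cdiv. rewrite Cmult_conj, Cpow_conj, Cinv_conj by apply factC_neq.
  now rewrite Cconj_RtoC.
Qed.

(** Row 0 of the displacement is a coherent state, so the terms are [exp (-|al|^2)] times those of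
    the exponential series at [-|al|^2]. *)
Lemma parterm_vacuum al :
  cseries (parterm al 0 0) (RtoC (exp (- 2 * Cmod al ^ 2))).
Proof.
  assert (H : forall l, dcoef al 0 l =
     (RtoC (exp (- (Cmod al ^ 2 / 2))) * taylor (- Cconj al) l 0)%C).
  { induction l as [|l IH].
    - rewrite dcoef_vacuum, taylor_00. ring.
    - apply (Cmult_cancel (Nc (S l))); [apply Nc_S_neq|].
      rewrite dcoef_lower_col, IH. cbn [prev].
      transitivity (RtoC (exp (- (Cmod al ^ 2 / 2))) *
        ((Nc (S l) - Nc 0) * taylor (- Cconj al) (S l) 0))%C; [|rewrite Nc_0; ring].
      rewrite taylor_S. ring. }
  assert (P : forall l, parterm al 0 0 l =
    (RtoC (exp (- Cmod al ^ 2)) * RtoC ((- Cmod al ^ 2) ^ l / INR (fact l)))%C).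
  { intros l. unfold parterm. rewrite H, Cmult_conj, Cconj_RtoC, Cconj_taylor.
    replace (exp (- Cmod al ^ 2)) with (exp (- (Cmod al ^ 2 / 2)) * exp (- (Cmod al ^ 2 / 2))).
    2:{ rewrite <- exp_plus. f_equal. field. }
    unfold taylor. cbn [Nat.leb]. rewrite Nat.sub_0_r.
    assert (E : ((- Cconj al) ^ l * Cconj (- Cconj al) ^ l = RtoC ((Cmod al ^ 2) ^ l))%C).
    { rewrite <- Cpow_mult_l, RtoC_pow, Cmod2_conj. f_equal.
      apply injective_projections; simpl; ring. }
    replace ((- Cmod al ^ 2) ^ l) with ((-1) ^ l * (Cmod al ^ 2) ^ l).
    2:{ rewrite <- Rpow_mult_distr. f_equal. ring. }
    unfold sign_fact, Rdiv. rewrite !RtoC_mult, <- E, RtoC_inv.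
    2:{ pose proof (fact_pos l); lra. }
    field. apply factC_neq. }
  eapply cseries_ext; [intros l; symmetry; apply P|].
  replace (- 2 * Cmod al ^ 2) with (- Cmod al ^ 2 + - Cmod al ^ 2) by ring.
  rewrite exp_plus, RtoC_mult. apply cseries_scal. split.
  - apply exp_series.
  - exact (proj2 cseries_zero).
Qed.

Lemma parterm_conj al j k l : Cconj (parterm al j k l) = parterm al k j l.
Proof.
  unfold parterm. rewrite !Cmult_conj, Cconj_conj. unfold sign_fact. rewrite Cconj_RtoC. ring.
Qed.

Lemma parterm_series al j k :
  cseries (parterm al j k)
    (RtoC (exp (- 2 * Cmod al ^ 2)) * gauss (-1) (2 * al) (2 * Cconj al) j k)%C.
Proof.
  set (E := RtoC (exp (- 2 * Cmod al ^ 2))).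
  assert (step : forall i m x y,
    x = (E * gauss (-1) (2 * al) (2 * Cconj al) i m)%C ->
    y = (E * prev (gauss (-1) (2 * al) (2 * Cconj al) i) m)%C ->
    (/ Nc (S i) * (2 * al * x - y) = E * gauss (-1) (2 * al) (2 * Cconj al) (S i) m)%C).
  { intros i m x y -> ->. apply (Cmult_cancel (Nc (S i))); [apply Nc_S_neq|].
    rewrite Ndiv.
    transitivity (E * (Nc (S i) * gauss (-1) (2 * al) (2 * Cconj al) (S i) m))%C; [|ring].
    rewrite gauss_S. ring. }
  (* The recursion raises only the row index, so it needs row 0 for every column. Column 0 is
     reached from the vacuum, and Hermitian symmetry of the terms turns it into row 0. *)
  assert (H0 : forall i, cseries (parterm al i 0) (E * taylor (2 * al) i 0)%C).
  { intros i. rewrite <- (gauss_0r (-1) _ (2 * Cconj al)).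
    induction i as [|i IH].
    - replace (gauss _ _ _ 0 0) with (RtoC 1).
      + rewrite Cmult_1_r. apply parterm_vacuum.
      + now rewrite gauss_0l, taylor_00.
    - rewrite <- (step i 0%nat _ (RtoC 0) eq_refl) by (cbn [prev]; ring).
      apply parterm_series_S; [exact IH|apply cseries_zero]. }
  revert k. induction j as [|j IH]; intros k.
  - rewrite gauss_0l.
    apply (cseries_ext (fun l => Cconj (parterm al k 0 l))).
    { intros l. apply parterm_conj. }
    replace (E * taylor (2 * Cconj al) k 0)%C with (Cconj (E * taylor (2 * al) k 0)%C).
    + apply cseries_conj, H0.
    + rewrite Cmult_conj, Cconj_taylor, Cmult_conj, Cconj_RtoC. unfold E.
      now rewrite Cconj_RtoC.
  - rewrite <- (step j k _ _ eq_refl eq_refl).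
    apply parterm_series_S; [apply IH|].
    destruct k; cbn [prev]; [rewrite Cmult_0_r; apply cseries_zero|apply IH].
Qed.

Lemma dparity_gauss al j k :
  dparity al j k = (RtoC (sqrt_fact j) * RtoC (sqrt_fact k) *
    (RtoC (exp (- 2 * Cmod al ^ 2)) * gauss (-1) (2 * al) (2 * Cconj al) j k))%C.
Proof.
  apply cseries_value.
  apply (cseries_ext (fun l => RtoC (sqrt_fact j) * RtoC (sqrt_fact k) * parterm al j k l)%C).
  - intros l. rewrite !disp_dcoef. unfold parterm, sign_fact.
    rewrite <- (sqrt_fact_sqr l), !Cmult_conj, !Cconj_RtoC, !RtoC_mult. ring.
  - apply cseries_scal, parterm_series.
Qed.

(** * Action of the Vertigo map on Wigner functions *)

Lemma csum_RtoC (f : nat -> R) n : sum_n (fun k => RtoC (f k)) n = RtoC (sum_f_R0 f n).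
Proof.
  induction n as [|n IH]; [apply csum_0|].
  rewrite csum_S, IH. simpl. now rewrite RtoC_plus.
Qed.

Lemma exp_coeff_plus x y m :
  sum_n (fun k => (exp_coeff x k * exp_coeff y (m - k))%C) m = exp_coeff (x + y) m.
Proof.
  unfold exp_coeff. rewrite (sum_n_ext _ (fun k => RtoC (x ^ k / INR (fact k) * (y ^ (m - k) / INR (fact (m - k)))))).
  2:{ intros k. now rewrite RtoC_mult. }
  rewrite csum_RtoC. f_equal. rewrite binomial. unfold Rdiv at 3. rewrite Rmult_comm, scal_sum.
  apply sum_eq. intros k Hk. unfold Binomial.C.
  pose proof (fact_pos m). pose proof (fact_pos k). pose proof (fact_pos (m - k)).
  field. lra.
Qed.

(** Regrouping by [m = k + l] and the binomial theorem add the two weights. Since [f] vanishes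
    beyond [N], cutting both sums at [N] loses nothing. *)
Lemma csum_antidiagonal (f : nat -> C) N x y :
  (forall m, (N < m)%nat -> f m = RtoC 0) ->
  sum_n (fun k => (exp_coeff x k * sum_n (fun l => (exp_coeff y l * f (l + k)%nat)%C) N)%C) N =
  sum_n (fun m => (exp_coeff (x + y) m * f m)%C) N.
Proof.
  intros Hf.
  rewrite (sum_n_ext _ (fun k => sum_n (fun m => if (k <=? m)%nat
      then (exp_coeff x k * (exp_coeff y (m - k) * f m))%C else RtoC 0) N)).
  2:{ intros k.
      rewrite (sum_n_ext _ (fun l => (exp_coeff y (l + k - k) * f (l + k)%nat)%C)).
      2:{ intros l. now replace (l + k - k)%nat with l by lia. }
      rewrite (csum_shift (fun m => (exp_coeff y (m - k) * f m)%C))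
        by (intros m Hm; rewrite (Hf m Hm); ring).
      rewrite <- csum_scal. apply sum_n_ext. intros m. destruct (k <=? m)%nat; cring. }
  rewrite sum_n_switch. apply sum_n_ext_loc. intros m Hm.
  rewrite (csum_widen _ m N Hm).
  2:{ intros k Hk. now rewrite (proj2 (Nat.leb_gt k m) Hk). }
  rewrite <- exp_coeff_plus. Ceq. rewrite Cmult_comm, <- csum_scal.
  apply sum_n_ext_loc. intros k Hk. rewrite (proj2 (Nat.leb_le k m) Hk). cring.
Qed.

(** * Factorial rescaling and composition of Vertigo maps *)

Definition fockm (A : op) : op := fun i j => (RtoC (sqrt_fact i) * RtoC (sqrt_fact j) * A i j)%C.

Lemma fockm_supported n A : supported n A -> supported n (fockm A).
Proof. intros H i j Hij. unfold fockm. rewrite H by exact Hij. ring. Qed.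

Lemma fockm_inj A B i j : fockm A i j = fockm B i j -> A i j = B i j.
Proof.
  intros H. apply (Cmult_cancel (RtoC (sqrt_fact i) * RtoC (sqrt_fact j))%C); [|exact H].
  apply Cmult_neq_0; apply sqrt_factC_neq.
Qed.

Lemma vertigo_finite n t A i j :
  supported n A ->
  vertigo t A i j =
  (RtoC (sqrt t ^ i * sqrt t ^ j) *
   sum_n (fun k => RtoC ((t - 1) ^ k / INR (fact k)
                           * sqrt (INR (fact (i + k)) / INR (fact i))
                           * sqrt (INR (fact (j + k)) / INR (fact j)))
                     * A (i + k)%nat (j + k)%nat)%C n)%C.
Proof.
  intros H. unfold vertigo. f_equal. apply CSeries_finite. intros k Hk.
  rewrite H by lia. ring.
Qed.

Lemma vertigo_supported n t A : supported n A -> supported n (vertigo t A).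
Proof.
  intros H i j Hij. rewrite (vertigo_finite n) by exact H.
  rewrite csum_zero; [ring|]. intros k _. rewrite H by lia. ring.
Qed.

Lemma sqrt_fact_ratio i k : sqrt_fact i * sqrt (INR (fact (i + k)) / INR (fact i)) = sqrt_fact (i + k).
Proof.
  pose proof (fact_pos i). pose proof (fact_pos (i + k)).
  unfold sqrt_fact. rewrite <- sqrt_mult; [f_equal; field; lra|lra|].
  apply Rlt_le, Rdiv_lt_0_compat; assumption.
Qed.

Lemma fockm_vertigo n t A i j :
  supported n A ->
  fockm (vertigo t A) i j =
  (RtoC (sqrt t ^ (i + j)) *
   sum_n (fun k => exp_coeff (t - 1) k * fockm A (i + k)%nat (j + k)%nat)%C n)%C.
Proof.
  intros H. unfold fockm at 1. rewrite (vertigo_finite n) by exact H.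
  transitivity (RtoC (sqrt t ^ (i + j)) * ((RtoC (sqrt_fact i) * RtoC (sqrt_fact j)) *
    sum_n (fun k => RtoC ((t - 1) ^ k / INR (fact k)
                           * sqrt (INR (fact (i + k)) / INR (fact i))
                           * sqrt (INR (fact (j + k)) / INR (fact j)))
                     * A (i + k)%nat (j + k)%nat)%C n))%C.
  { rewrite pow_add. ring. }
  f_equal. rewrite <- csum_scal. apply sum_n_ext. intros k. unfold fockm, exp_coeff.
  rewrite <- (sqrt_fact_ratio i k), <- (sqrt_fact_ratio j k), !RtoC_mult. cring.
Qed.

Lemma exp_coeff_scale (t : R) x k : (RtoC (t ^ k) * exp_coeff x k)%C = exp_coeff (x * t) k.
Proof.
  unfold exp_coeff. rewrite <- RtoC_mult. f_equal. rewrite Rpow_mult_distr. unfold Rdiv. ring.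
Qed.

Lemma sqrt_pow2k t k : 0 <= t -> sqrt t ^ (k + k) = t ^ k.
Proof.
  intros Ht. rewrite pow_add, <- Rpow_mult_distr, sqrt_sqrt by exact Ht. reflexivity.
Qed.

Lemma exp_coeff_null m : exp_coeff 0 m = if Nat.eqb m 0 then RtoC 1 else RtoC 0.
Proof.
  destruct m; [apply exp_coeff_0|]. unfold exp_coeff. simpl Nat.eqb. cbn iota. f_equal.
  simpl pow. unfold Rdiv. ring.
Qed.

(** The outer shift by [k] meets an inner factor [sqrt t ^ (2k) = t^k], so its weight parameter
    becomes [(s-1) t]. The total parameter [s t - 1] is zero and only the unshifted entry
    survives. *)
Lemma vertigo_inverse n s t A i j :
  0 < s -> 0 < t -> s * t = 1 -> supported n A ->
  vertigo s (vertigo t A) i j = A i j.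
Proof.
  intros Hs Ht Hst HA. apply fockm_inj.
  rewrite (fockm_vertigo n) by (now apply vertigo_supported).
  rewrite (sum_n_ext _ (fun k => (RtoC (sqrt t ^ (i + j)) *
    (exp_coeff ((s - 1) * t) k * sum_n (fun l => exp_coeff (t - 1) l * fockm A (i + (l + k))%nat (j + (l + k))%nat)%C n))%C)).
  2:{ intros k. rewrite (fockm_vertigo n) by exact HA.
      rewrite <- exp_coeff_scale, <- (sqrt_pow2k t k) by lra.
      replace (i + k + (j + k))%nat with ((i + j) + (k + k))%nat by lia.
      rewrite (pow_add (sqrt t) (i + j)), RtoC_mult.
      rewrite (sum_n_ext (fun l => (exp_coeff (t - 1) l * fockm A (i + k + l)%nat (j + k + l)%nat)%C)
        (fun l => (exp_coeff (t - 1) l * fockm A (i + (l + k))%nat (j + (l + k))%nat)%C)).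
      - cring.
      - intros l. now replace (i + k + l)%nat with (i + (l + k))%nat by lia;
          replace (j + k + l)%nat with (j + (l + k))%nat by lia. }
  rewrite csum_scal.
  rewrite (csum_antidiagonal (fun m => fockm A (i + m)%nat (j + m)%nat)).
  2:{ intros m Hm. apply (fockm_supported n A HA). lia. }
  replace ((s - 1) * t + (t - 1)) with 0 by nra.
  rewrite (csum_single _ 0%nat); [|lia|].
  - rewrite exp_coeff_0, !Nat.add_0_r, Cmult_1_l, Cmult_assoc, <- RtoC_mult, <- Rpow_mult_distr.
    rewrite <- sqrt_mult, Hst, sqrt_1, pow1 by lra. ring.
  - intros k _ Hk. rewrite exp_coeff_null. destruct k; [lia|]. simpl Nat.eqb. cbn iota. ring.
Qed.

(** * Wigner functions of finitely supported operators *)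

Definition pairing (n : nat) (A M : op) : C :=
  sum_n (fun j => sum_n (fun k => (A j k * M k j)%C) n) n.

Lemma wigner_supported n A al :
  supported n A ->
  wigner A al = (RtoC (2 / PI) * RtoC (exp (- 2 * Cmod al ^ 2)) *
    pairing n (fockm A) (gauss (-1) (2 * al) (2 * Cconj al)))%C.
Proof.
  intros H. unfold wigner, pairing.
  rewrite (CSeries_finite _ n).
  2:{ intros j Hj. rewrite (CSeries_finite _ 0); [rewrite csum_0|intros]; rewrite H by lia; ring. }
  rewrite <- Cmult_assoc. f_equal. rewrite <- csum_scal. apply sum_n_ext. intros j.
  rewrite (CSeries_finite _ n) by (intros k Hk; rewrite H by lia; ring).
  rewrite <- csum_scal. apply sum_n_ext. intros k.
  rewrite dparity_gauss. unfold fockm. cring.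
Qed.

Lemma taylor_scale (r : R) a j s :
  (s <= j)%nat -> (RtoC (r ^ (j - s)) * taylor a j s)%C = taylor (RtoC r * a) j s.
Proof.
  intros H. unfold taylor. rewrite (proj2 (Nat.leb_le s j) H), Cpow_mult_l, RtoC_pow.
  field. apply factC_neq.
Qed.

Lemma gauss_scale r c a b j k :
  (RtoC (r ^ (j + k)) * gauss c a b j k)%C = gauss (c * r ^ 2) (RtoC r * a) (RtoC r * b) j k.
Proof.
  unfold gauss. rewrite <- csum_scal. apply sum_n_ext_loc. intros s Hs.
  (* The exponent splits as [2s + (j-s) + (k-s)] only for [s <= k]; for larger [s] both terms
     vanish. *)
  destruct (Nat.le_gt_cases s k) as [Hk|Hk].
  - rewrite <- !taylor_scale by assumption. rewrite <- exp_coeff_scale.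
    replace (j + k)%nat with (s * 2 + ((j - s) + (k - s)))%nat by lia.
    rewrite !pow_add, <- (pow_mult r 2 s), (Nat.mul_comm 2 s), !RtoC_mult. cring.
  - rewrite !(taylor_0 _ k) by exact Hk. cring.
Qed.

Lemma csum_bilinear (f : nat -> nat -> nat -> C) (w : nat -> C) n :
  sum_n (fun j => sum_n (fun k => sum_n (fun s => (w s * f s j k)%C) n) n) n =
  sum_n (fun s => (w s * sum_n (fun j => sum_n (fun k => f s j k) n) n)%C) n.
Proof.
  rewrite (sum_n_ext _ (fun j => sum_n (fun s => (w s * sum_n (fun k => f s j k) n)%C) n)).
  2:{ intros j. rewrite sum_n_switch. apply sum_n_ext. intros s. apply csum_scal. }
  rewrite sum_n_switch. apply sum_n_ext. intros s. apply csum_scal.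
Qed.

Lemma csum_shift2 (g : nat -> nat -> C) s n :
  (forall j k, (n < j \/ n < k)%nat -> g j k = RtoC 0) ->
  (forall j k, (j < s \/ k < s)%nat -> g j k = RtoC 0) ->
  sum_n (fun j => sum_n (fun k => g (j + s)%nat (k + s)%nat) n) n =
  sum_n (fun j => sum_n (fun k => g j k) n) n.
Proof.
  intros Hn Hs.
  assert (one : forall f : nat -> C, (forall m, (n < m)%nat -> f m = RtoC 0) ->
    (forall m, (m < s)%nat -> f m = RtoC 0) ->
    sum_n (fun i => f (i + s)%nat) n = sum_n f n).
  { intros f H1 H2. rewrite csum_shift by exact H1. apply sum_n_ext. intros m.
    destruct (Nat.leb_spec s m); [reflexivity|]. symmetry. now apply H2. }
  rewrite (sum_n_ext _ (fun j => (fun p => sum_n (g p) n) (j + s)%nat)).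
  2:{ intros j. apply one; intros m Hm; [apply Hn|apply Hs]; lia. }
  apply (one (fun p => sum_n (g p) n)); intros m Hm; apply csum_zero; intros k _;
    [apply Hn|apply Hs]; lia.
Qed.

(** The diagonal shifts of V_t act on the Gaussian as multiplication by [exp ((t-1) x y)], and the
    powers of [sqrt t] rescale both variables, turning [-x y] into [-t x y]. Together these restore
    the coefficient -1, leaving only scaled linear terms. *)
Lemma pairing_vertigo n t A a b :
  0 <= t -> supported n A ->
  pairing n (fockm (vertigo t A)) (gauss (-1) a b) =
  pairing n (fockm A) (gauss (-1) (RtoC (sqrt t) * a) (RtoC (sqrt t) * b)).
Proof.
  intros Ht HA. set (a' := (RtoC (sqrt t) * a)%C). set (b' := (RtoC (sqrt t) * b)%C).
  set (g := fun m j k => (fockm A j k * (taylor a' k m * taylor b' j m))%C).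
  (* [f m] is the pairing of [A] with [x^m y^m exp (a' x + b' y)], so the coefficient of [x y] in
     the exponent enters only through the weights. *)
  set (f := fun m => sum_n (fun j => sum_n (fun k => g m j k) n) n).
  assert (Hf : forall c, pairing n (fockm A) (gauss c a' b') =
             sum_n (fun m => (exp_coeff c m * f m)%C) n).
  { intros c. unfold pairing, f.
    rewrite <- (csum_bilinear g). apply sum_n_ext. intros j.
    apply sum_n_ext_loc. intros k Hk. rewrite (gauss_widen _ _ _ _ _ n Hk), <- csum_scal.
    apply sum_n_ext. intros s. unfold g. cring. }
  rewrite Hf. replace (exp_coeff (-1)) with (exp_coeff ((t - 1) + (-1 * sqrt t ^ 2))).
  2:{ f_equal. rewrite <- Rsqr_pow2, Rsqr_sqrt by exact Ht. ring. }
  rewrite <- (csum_antidiagonal f).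
  2:{ intros m Hm. unfold f. apply csum_zero. intros j _. apply csum_zero. intros k Hk.
      unfold g. rewrite (taylor_0 a') by lia. ring. }
  unfold pairing.
  rewrite (sum_n_ext _ (fun j => sum_n (fun k => sum_n (fun s => (exp_coeff (t - 1) s *
    (fockm A (j + s)%nat (k + s)%nat * gauss (-1 * sqrt t ^ 2) a' b' k j))%C) n) n)).
  2:{ intros j. apply sum_n_ext. intros k. rewrite (fockm_vertigo n) by exact HA.
      unfold a', b'. rewrite <- gauss_scale, (Nat.add_comm j k).
      transitivity (RtoC (sqrt t ^ (k + j)) * gauss (-1) a b k j *
        sum_n (fun k0 => exp_coeff (t - 1) k0 * fockm A (j + k0)%nat (k + k0)%nat) n)%C; [cring|].
      rewrite <- csum_scal. apply sum_n_ext. intros s. cring. }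
  rewrite (csum_bilinear (fun s j k => (fockm A (j + s)%nat (k + s)%nat * gauss (-1 * sqrt t ^ 2) a' b' k j)%C)).
  apply sum_n_ext. intros s. f_equal.
  set (c := -1 * sqrt t ^ 2).
  (* [taylor] depends only on the difference of its indices, so shifting [j], [k] and [u] by [s]
     together turns the summand into a term of [f (u + s)]. *)
  rewrite (sum_n_ext _ (fun j => sum_n (fun k => sum_n (fun u =>
     (exp_coeff c u * (fun u j k => g (u + s)%nat (j + s)%nat (k + s)%nat) u j k)%C) n) n)).
  2:{ intros j. apply sum_n_ext_loc. intros k Hk.
      rewrite (gauss_widen _ _ _ _ _ n Hk), <- csum_scal. apply sum_n_ext. intros u.
      unfold g. rewrite !taylor_add. cring. }
  rewrite csum_bilinear. apply sum_n_ext. intros u. f_equal. unfold f.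
  apply (csum_shift2 (fun j k => g (u + s)%nat j k)).
  - intros j k H. unfold g. rewrite (fockm_supported n A HA) by exact H. ring.
  - intros j k [H|H]; unfold g; [rewrite (taylor_0 b') by lia|rewrite (taylor_0 a') by lia]; ring.
Qed.

(** The scaled argument brings the Gaussian [exp (-2 t |al|^2)]; the prefactor is its quotient with
    [exp (-2 |al|^2)]. *)
Lemma wigner_vertigo n t A al :
  0 <= t -> supported n A ->
  wigner (vertigo t A) al =
  (RtoC (exp (2 * (t - 1) * Cmod al ^ 2)) * wigner A (RtoC (sqrt t) * al))%C.
Proof.
  intros Ht HA.
  rewrite (wigner_supported n A), (wigner_supported n) by (try apply vertigo_supported; exact HA).
  rewrite pairing_vertigo by assumption.
  replace (2 * (RtoC (sqrt t) * al))%C with (RtoC (sqrt t) * (2 * al))%C by ring.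
  replace (2 * Cconj (RtoC (sqrt t) * al))%C with (RtoC (sqrt t) * (2 * Cconj al))%C.
  2:{ rewrite Cmult_conj, Cconj_RtoC. ring. }
  replace (exp (- 2 * Cmod al ^ 2)) with
    (exp (2 * (t - 1) * Cmod al ^ 2) * exp (- 2 * Cmod (RtoC (sqrt t) * al) ^ 2)).
  - rewrite RtoC_mult. ring.
  - rewrite <- exp_plus. f_equal. rewrite Cmod_mult, Cmod_R, Rabs_pos_eq by apply sqrt_pos.
    rewrite Rpow_mult_distr, pow2_sqrt by exact Ht. ring.
Qed.

(** * Extreme points under the Vertigo map *)

Lemma vertigo_hermitian n t A :
  supported n A -> hermitian A -> hermitian (vertigo t A).
Proof.
  intros HA Hh i j. rewrite !(vertigo_finite n) by exact HA.
  rewrite Cmult_conj, Cconj_RtoC, csum_conj. f_equal; [apply (f_equal RtoC); ring|].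
  apply sum_n_ext. intros k. rewrite Cmult_conj, Cconj_RtoC, <- Hh. f_equal. apply (f_equal RtoC). ring.
Qed.

(** * Linearity of the trace, the Wigner function and the Vertigo map *)

Definition lin_comb (c d : R) (A B : op) : op := fun i j => (RtoC c * A i j + RtoC d * B i j)%C.

Lemma lin_comb_supported n c d A B : supported n A -> supported n B -> supported n (lin_comb c d A B).
Proof. intros HA HB i j H. unfold lin_comb. rewrite HA, HB by exact H. ring. Qed.

Lemma lin_comb_hermitian c d A B : hermitian A -> hermitian B -> hermitian (lin_comb c d A B).
Proof.
  intros HA HB i j. unfold lin_comb.
  now rewrite Cplus_conj, !Cmult_conj, !Cconj_RtoC, <- HA, <- HB.
Qed.

Lemma trace_supported n A : supported n A -> op_trace A = sum_n (fun i => A i i) n.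
Proof. intros H. apply CSeries_finite. intros k Hk. apply H. lia. Qed.

Lemma trace_lin_comb n c d A B :
  supported n A -> supported n B ->
  op_trace (lin_comb c d A B) = (RtoC c * op_trace A + RtoC d * op_trace B)%C.
Proof.
  intros HA HB. rewrite !(trace_supported n) by (try apply lin_comb_supported; assumption).
  rewrite <- !csum_scal, <- csum_plus. reflexivity.
Qed.

Lemma wigner_lin_comb n c d A B al :
  supported n A -> supported n B ->
  wigner (lin_comb c d A B) al = (RtoC c * wigner A al + RtoC d * wigner B al)%C.
Proof.
  intros HA HB. rewrite !(wigner_supported n) by (try apply lin_comb_supported; assumption).
  set (M := gauss _ _ _).
  assert (E : pairing n (fockm (lin_comb c d A B)) M =
     (RtoC c * pairing n (fockm A) M + RtoC d * pairing n (fockm B) M)%C).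
  { unfold pairing. rewrite <- !csum_scal, <- csum_plus. apply sum_n_ext. intros j.
    rewrite <- !csum_scal, <- csum_plus. apply sum_n_ext. intros k.
    unfold fockm, lin_comb. cring. }
  rewrite E. ring.
Qed.

Lemma Re_RtoC_mult (c : R) (z : C) : Re (RtoC c * z)%C = c * Re z.
Proof. destruct z. simpl. ring. Qed.

Lemma Re_wigner_lin_comb n c d A B al :
  supported n A -> supported n B ->
  Re (wigner (lin_comb c d A B) al) = c * Re (wigner A al) + d * Re (wigner B al).
Proof.
  intros HA HB. rewrite (wigner_lin_comb n) by assumption.
  rewrite <- !Re_RtoC_mult. reflexivity.
Qed.

Lemma vertigo_lin_comb n t c d A B i j :
  supported n A -> supported n B ->
  vertigo t (lin_comb c d A B) i j = lin_comb c d (vertigo t A) (vertigo t B) i j.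
Proof.
  intros HA HB. unfold lin_comb at 2.
  rewrite !(vertigo_finite n) by (try apply lin_comb_supported; assumption).
  transitivity (RtoC (sqrt t ^ i * sqrt t ^ j) *
    (RtoC c * sum_n (fun k => RtoC ((t - 1) ^ k / INR (fact k)
                           * sqrt (INR (fact (i + k)) / INR (fact i))
                           * sqrt (INR (fact (j + k)) / INR (fact j)))
                     * A (i + k)%nat (j + k)%nat)%C n +
     RtoC d * sum_n (fun k => RtoC ((t - 1) ^ k / INR (fact k)
                           * sqrt (INR (fact (i + k)) / INR (fact i))
                           * sqrt (INR (fact (j + k)) / INR (fact j)))
                     * B (i + k)%nat (j + k)%nat)%C n))%C; [|ring].
  f_equal. rewrite <- !csum_scal, <- csum_plus. apply sum_n_ext. intros k.
  unfold lin_comb. cring.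
Qed.

(** * Quasi-states of finite support *)

Lemma l2norm_zero x : (forall i, x i = RtoC 0) -> l2norm x = 0.
Proof.
  intros H. unfold l2norm.
  rewrite (Series_ext _ (fun _ => 0 * 0)).
  2:{ intros i. rewrite H, Cmod_0. ring. }
  rewrite Series_scal_l, Rmult_0_l. apply sqrt_0.
Qed.

Lemma l2_finite x n : (forall i, (n < i)%nat -> x i = RtoC 0) -> l2 x.
Proof.
  intros H. eexists. apply (is_series_finite (V := R_NormedModule) _ n).
  intros i Hi. rewrite H by exact Hi. rewrite Cmod_0. apply Rmult_0_l.
Qed.

Lemma supported_trace_class n A : supported n A -> trace_class A.
Proof.
  intros HA.
  (* Column decomposition: [A] is the sum of [A|k><k|], whose terms vanish for [k > n]. *)
  exists (fun k i => A i k), (fun k j => if Nat.eqb j k then RtoC 1 else RtoC 0).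
  split; [|split; [|split]].
  - intros k. apply (l2_finite _ n). intros i Hi. apply HA. lia.
  - intros k. apply (l2_finite _ k). intros i Hi.
    now rewrite (proj2 (Nat.eqb_neq i k)) by lia.
  - eexists. apply (is_series_finite (V := R_NormedModule) _ n).
    intros k Hk. rewrite (l2norm_zero (fun i => A i k)) by (intros i; apply HA; lia).
    apply Rmult_0_l.
  - intros i j.
    refine (eq_ind _ (is_series _) (is_series_finite (V := C_NormedModule) _ (n + j) _) _ _).
    (* The cutoff [n + j] passes the support and still contains the index [j] when [j > n]. *)
    + intros k Hk. rewrite HA by lia. apply Cmult_0_l.
    + rewrite (csum_single _ j); [|lia|].
      * rewrite Nat.eqb_refl, Cconj_RtoC. apply Cmult_1_r.
      * intros k _ Hk. rewrite (proj2 (Nat.eqb_neq j k)) by lia.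
        rewrite Cconj_RtoC. apply Cmult_0_r.
Qed.

Lemma supported_quasi_state n A :
  supported n A -> hermitian A -> op_trace A = RtoC 1 -> quasi_state A.
Proof.
  intros HA Hh Ht. split; [exact Hh|split; [now apply (supported_trace_class n)|]].
  rewrite <- Ht, (trace_supported n) by exact HA.
  apply (is_series_finite (V := C_NormedModule)). intros k Hk. apply HA. lia.
Qed.

Lemma quasi_state_trace n A : supported n A -> quasi_state A -> op_trace A = RtoC 1.
Proof.
  intros HA [_ [_ H]]. rewrite (trace_supported n) by exact HA.
  refine (filterlim_locally_unique (V := C_NormedModule) _ _ _ _ H).
  apply (is_series_finite (V := C_NormedModule)). intros k Hk. apply HA. lia.
Qed.

Lemma hermitian_diag A i : hermitian A -> A i i = RtoC (Re (A i i)).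
Proof.
  intros H. specialize (H i i). apply (f_equal Im) in H. rewrite im_conj in H.
  apply injective_projections; simpl; [reflexivity|]. unfold Im in H. lra.
Qed.

Lemma hermitian_trace n A :
  supported n A -> hermitian A -> op_trace A = RtoC (Re (op_trace A)).
Proof.
  intros HA Hh. rewrite (trace_supported n) by exact HA.
  rewrite csum_Re, sum_n_Reals, <- csum_RtoC. apply sum_n_ext. intros i.
  now apply hermitian_diag.
Qed.

(** [A] is the midpoint of [A + H] and [A - H], both of which stay in the convex set, so they
    coincide. *)
Lemma extr_no_perturbation n A H :
  extr (An_plus n) A -> supported n H -> hermitian H -> op_trace H = RtoC 0 ->
  (forall al, - Re (wigner A al) <= Re (wigner H al) <= Re (wigner A al)) ->
  forall i j, H i j = RtoC 0.
Proof.
  intros [[HqA [HsA HwA]] Hex] HsH HhH HtH Hw i j.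
  pose proof (quasi_state_trace n A HsA HqA) as HtA. destruct HqA as [HhA _].
  assert (An : forall c, (c = 1 \/ c = -1) -> An_plus n (lin_comb 1 c A H)).
  { intros c Hc. pose proof (lin_comb_supported n 1 c A H HsA HsH) as Hs.
    split; [|split; [exact Hs|]].
    - apply (supported_quasi_state n); [exact Hs|now apply lin_comb_hermitian|].
      rewrite (trace_lin_comb n), HtA, HtH by assumption. ring.
    - intros al. rewrite (Re_wigner_lin_comb n) by assumption. specialize (Hw al).
      destruct Hc as [-> | ->]; lra. }
  assert (E : lin_comb 1 1 A H i j = lin_comb 1 (-1) A H i j).
  { apply (Hex _ _ (1 / 2)); [apply An; auto|apply An; auto|lra|].
    intros p q. unfold comb, lin_comb. apply injective_projections; simpl; field. }
  unfold lin_comb in E. pose proof (f_equal Re E) as E1. pose proof (f_equal Im E) as E2.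
  simpl in E1, E2. apply injective_projections; simpl; unfold Re, Im in *; lra.
Qed.

(* The components are pulled back by the inverse map V_{1/t}; subtracting from
   the pulled-back Y its trace times A leaves a direction in which A could be
   moved both ways inside [An_plus n], unless it vanishes. *)
Lemma vertigo_component n A t T lam Y Z :
  extr (An_plus n) A -> 0 < t -> 0 < T -> 0 < lam < 1 ->
  supported n Y -> hermitian Y -> wigner_nonneg Y ->
  supported n Z -> wigner_nonneg Z ->
  (forall i j, vertigo t A i j = lin_comb (T * lam) (T * (1 - lam)) Y Z i j) ->
  exists y : R, forall i j, Y i j = (RtoC y * vertigo t A i j)%C.
Proof.
  intros HA Ht HT Hlam HsY HhY HwY HsZ HwZ Hdec.
  pose proof (proj1 HA) as [HqA [HsA HwA]].
  pose proof (quasi_state_trace n A HsA HqA) as HtA. pose proof (proj1 HqA) as HhA.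
  assert (Hs : 0 < / t) by now apply Rinv_0_lt_compat.
  set (Y' := vertigo (/ t) Y). set (Z' := vertigo (/ t) Z).
  pose proof (vertigo_supported n (/ t) Y HsY : supported n Y') as HsY'.
  pose proof (vertigo_supported n (/ t) Z HsZ : supported n Z') as HsZ'.
  pose proof (vertigo_hermitian n (/ t) Y HsY HhY : hermitian Y') as HhY'.
  assert (pos : forall B, supported n B -> wigner_nonneg B -> wigner_nonneg (vertigo (/ t) B)).
  { intros B HB HwB al. rewrite (wigner_vertigo n) by (try lra; exact HB).
    rewrite Re_RtoC_mult. apply Rmult_le_pos; [left; apply exp_pos|apply HwB]. }
  assert (EA : A = lin_comb (T * lam) (T * (1 - lam)) Y' Z').
  { apply functional_extensionality; intros i. apply functional_extensionality; intros j.
    rewrite <- (vertigo_inverse n (/ t) t A i j) by (try exact HsA; try exact Hs; try exact Ht; field; lra).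
    replace (vertigo t A) with (lin_comb (T * lam) (T * (1 - lam)) Y Z).
    - now apply (vertigo_lin_comb n).
    - apply functional_extensionality; intros p. apply functional_extensionality; intros q.
      symmetry. apply Hdec. }
  (* Dropping the non-negative Wigner function of [Z'] from the decomposition [EA] bounds that of
     [Y'] by [q] times that of [A]. *)
  set (y := Re (op_trace Y')). set (q := / (T * lam)).
  assert (HTl : 0 < T * lam) by nra.
  assert (Hq : 0 < q) by now apply Rinv_0_lt_compat.
  pose proof (Rabs_pos y) as Hy.
  (* The Wigner function of [Y' - y A] is at most [q + |y|] times that of [A] in absolute value, so
     scaling by [dl] brings it within the two-sided bound. *)
  set (dl := / (1 + Rabs y + q)).
  assert (Hdl : 0 < dl) by (apply Rinv_0_lt_compat; lra).
  assert (Hdl' : dl * (1 + Rabs y + q) = 1) by (apply Rinv_l; lra).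
  assert (HH : forall i j, lin_comb dl (- dl * y) Y' A i j = RtoC 0).
  { apply (extr_no_perturbation n A); [exact HA|now apply lin_comb_supported|now apply lin_comb_hermitian| |].
    - rewrite (trace_lin_comb n), HtA, (hermitian_trace n Y') by assumption. fold y.
      rewrite RtoC_mult, RtoC_opp. ring.
    - intros al. rewrite (Re_wigner_lin_comb n) by assumption.
      pose proof (Re_wigner_lin_comb n (T * lam) (T * (1 - lam)) Y' Z' al HsY' HsZ') as EW.
      rewrite <- EA in EW.
      pose proof (HwA al) as w0. pose proof (pos Y HsY HwY al) as u0. fold Y' in u0.
      pose proof (pos Z HsZ HwZ al) as v0. fold Z' in v0.
      set (w := Re (wigner A al)) in *. set (u := Re (wigner Y' al)) in *.
      set (v := Re (wigner Z' al)) in *.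
      assert (Hu : u <= q * w).
      { rewrite EW. assert (0 <= q * (T * (1 - lam) * v)).
        { apply Rmult_le_pos; [lra|]. apply Rmult_le_pos; [nra|exact v0]. }
        assert (q * (T * lam * u) = u) by (unfold q; field; lra). lra. }
      pose proof (Rle_abs y). pose proof (Rle_abs (- y)). rewrite Rabs_Ropp in *.
      assert (0 <= dl * w) by (apply Rmult_le_pos; lra).
      assert (dl * u <= dl * (q * w)) by (apply Rmult_le_compat_l; lra).
      assert (0 <= dl * u) by (apply Rmult_le_pos; lra).
      assert (w = dl * w + dl * w * Rabs y + dl * (q * w)).
      { transitivity ((dl * (1 + Rabs y + q)) * w); [rewrite Hdl'|]; ring. }
      assert (dl * w * y <= dl * w * Rabs y) by (apply Rmult_le_compat_l; lra).
      assert (dl * w * (- y) <= dl * w * Rabs y) by (apply Rmult_le_compat_l; lra).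
      assert (0 <= dl * (q * w)) by (apply Rmult_le_pos; [lra|]; apply Rmult_le_pos; lra).
      split; lra. }
  exists y. intros i j.
  rewrite <- (vertigo_inverse n t (/ t) Y i j) by (try exact HsY; try exact Hs; try exact Ht; field; lra).
  (* The multiple [y A] is written as a linear combination of [A] with itself, so that linearity of
     the Vertigo map applies. *)
  fold Y'. replace Y' with (lin_comb y 0 A A).
  - rewrite (vertigo_lin_comb n) by assumption. unfold lin_comb. ring.
  - apply functional_extensionality; intros p. apply functional_extensionality; intros r.
    specialize (HH p r). unfold lin_comb in *.
    apply (Cmult_cancel (RtoC dl)); [apply RtoC_neq; lra|].
    apply Cminus_eq. transitivity (- (RtoC dl * Y' p r + RtoC (- dl * y) * A p r))%C.
    + rewrite RtoC_mult, RtoC_opp. ring.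
    + rewrite HH. ring.
Qed.

(** * Positivity for large t *)

Definition quadform (N : nat) (A : op) (x : nat -> C) : C :=
  sum_n (fun i => sum_n (fun j => (Cconj (x i) * A i j * x j)%C) N) N.

(** The test vector is cut off at [N]; then the cutoffs [n] and [N] both agree with the common
    cutoff [N + n], one because of [A], the other because of the vector. *)
Lemma supported_psd n A :
  supported n A -> (forall x, 0 <= Re (quadform n A x)) -> psd A.
Proof.
  intros HA H N x. set (x' := fun k => if (k <=? N)%nat then x k else RtoC 0).
  assert (Hx : forall k, (N < k)%nat -> x' k = RtoC 0).
  { intros k Hk. unfold x'. now rewrite (proj2 (Nat.leb_gt k N) Hk). }
  assert (Hx' : forall k, (k <= N)%nat -> x' k = x k).
  { intros k Hk. unfold x'. now rewrite (proj2 (Nat.leb_le k N) Hk). }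
  replace (sum_n _ N) with (quadform n A x'); [apply H|].
  transitivity (quadform (N + n) A x'); unfold quadform.
  - symmetry. rewrite (csum_widen _ n); [|lia|].
    + apply sum_n_ext. intros i. apply csum_widen; [lia|]. intros k Hk.
      rewrite HA by lia. ring.
    + intros i Hi. apply csum_zero. intros k _. rewrite HA by lia. ring.
  - rewrite (csum_widen _ N); [|lia|].
    + apply sum_n_ext_loc. intros i Hi. rewrite (csum_widen _ N); [|lia|].
      * apply sum_n_ext_loc. intros k Hk. now rewrite !Hx'.
      * intros k Hk. rewrite (Hx k) by exact Hk. ring.
    + intros i Hi. apply csum_zero. intros k _. rewrite (Hx i) by exact Hi.
      rewrite Cconj_RtoC. ring.
Qed.

Lemma rsum_le (f g : nat -> R) n :
  (forall k, (k <= n)%nat -> f k <= g k) -> sum_n f n <= sum_n g n.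
Proof. intros H. rewrite !sum_n_Reals. now apply sum_Rle. Qed.

Lemma rsum_ge_term (f : nat -> R) i n :
  (forall k, 0 <= f k) -> (i <= n)%nat -> f i <= sum_n f n.
Proof.
  intros H. induction n as [|n IH]; intros Hi.
  - rewrite sum_O. replace i with 0%nat by lia. lra.
  - rewrite sum_Sn. change (f i <= sum_n f n + f (S n)).
    destruct (Nat.eq_dec i (S n)) as [->|].
    + assert (0 <= sum_n f n).
      { rewrite sum_n_Reals. now apply cond_pos_sum. }
      lra.
    + pose proof (H (S n)). specialize (IH ltac:(lia)). lra.
Qed.

Lemma rsum_lin_comb (a b : R) (f : nat -> R) n :
  sum_n (fun k => a * f k + b) n = a * sum_n f n + INR (S n) * b.
Proof.
  rewrite !sum_n_Reals, (sum_plus (fun k => a * f k) (fun _ => b)).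
  rewrite sum_cte. rewrite (sum_eq (fun k => a * f k) (fun k => f k * a)) by (intros; ring).
  rewrite <- scal_sum. match goal with |- ?u = ?v => change (@eq R u v) end. ring.
Qed.

Lemma rsum_indicator (a : R) i n :
  (i <= n)%nat -> sum_n (fun j => if Nat.eqb i j then a else 0) n = a.
Proof.
  intros Hi. apply RtoC_inj. rewrite sum_n_Reals, <- csum_RtoC.
  rewrite (csum_single _ i) by
    (try exact Hi; intros k _ Hk; now rewrite (proj2 (Nat.eqb_neq i k)) by lia).
  now rewrite Nat.eqb_refl.
Qed.

(** By [2 |x_i| |x_j| <= |x_i|^2 + |x_j|^2], the perturbation contributes at least
    [-(n+1) eps |x|^2] over all pairs, against at least [delta |x|^2] from the diagonal. *)
Lemma dominant_diagonal_quadform n A (d : nat -> R) delta eps x :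
  (forall i, (i <= n)%nat -> delta <= d i) ->
  (forall i j, (i <= n)%nat -> (j <= n)%nat ->
     Cmod (A i j - (if Nat.eqb i j then RtoC (d i) else RtoC 0)) <= eps) ->
  INR (S n) * eps <= delta ->
  0 <= Re (quadform n A x).
Proof.
  intros Hd He Hde. set (y := fun i => Cmod (x i) ^ 2). set (S0 := sum_n y n).
  assert (Hy : forall i, 0 <= y i) by (intros; apply pow2_ge_0).
  assert (HS : 0 <= S0) by (unfold S0; rewrite sum_n_Reals; now apply cond_pos_sum).
  assert (term : forall i j, (i <= n)%nat -> (j <= n)%nat ->
    (if Nat.eqb i j then delta * y i else 0) + (- (eps / 2) * y j + - (eps / 2) * y i)
    <= Re (Cconj (x i) * A i j * x j)%C).
  { intros i j Hi Hj. specialize (He i j Hi Hj).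
    set (D := if Nat.eqb i j then RtoC (d i) else RtoC 0) in *.
    set (z := (Cconj (x i) * (A i j - D) * x j)%C).
    assert (Hz : - Re z <= eps / 2 * (y i + y j)).
    { apply Rle_trans with (Cmod z).
      - pose proof (re_le_Cmod z). pose proof (Rle_abs (- Re z)). rewrite Rabs_Ropp in *. lra.
      - unfold z. rewrite !Cmod_mult, Cmod_conj. unfold y.
        pose proof (Cmod_ge_0 (x i)). pose proof (Cmod_ge_0 (x j)).
        pose proof (Cmod_ge_0 (A i j - D)).
        assert (0 <= Cmod (x i) * Cmod (x j)) by now apply Rmult_le_pos.
        assert (Cmod (A i j - D) * (Cmod (x i) * Cmod (x j)) <= eps * (Cmod (x i) * Cmod (x j)))
          by now apply Rmult_le_compat_r.
        assert (0 <= eps * (Cmod (x i) - Cmod (x j)) ^ 2).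
        { apply Rmult_le_pos; [lra|apply pow2_ge_0]. }
        nra. }
    assert (HD : (if Nat.eqb i j then delta * y i else 0) <= Re (Cconj (x i) * D * x j)%C).
    { unfold D. destruct (Nat.eqb_spec i j) as [E|]; [rewrite <- E|].
      - replace (Cconj (x i) * RtoC (d i) * x i)%C with (RtoC (d i) * RtoC (y i))%C.
        + rewrite Re_RtoC_mult. simpl. apply Rmult_le_compat_r; [apply Hy|now apply Hd].
        + unfold y. rewrite Cmod2_conj. ring.
      - replace (Cconj (x i) * RtoC 0 * x j)%C with (RtoC 0) by ring. simpl. lra. }
    replace (Cconj (x i) * A i j * x j)%C with (Cconj (x i) * D * x j + z)%C by (unfold z; ring).
    change (Re (?a + ?b)%C) with (Re a + Re b). lra. }
  assert (row : forall i, (i <= n)%nat ->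
    (delta - INR (S n) * (eps / 2)) * y i + - (eps / 2) * S0 <=
    Re (sum_n (fun j => (Cconj (x i) * A i j * x j)%C) n)).
  { intros i Hi. rewrite csum_Re.
    eapply Rle_trans; [|apply rsum_le; intros j Hj; apply (term i j Hi Hj)].
    rewrite (sum_n_plus (G := R_AbelianMonoid)
      (fun j => if Nat.eqb i j then delta * y i else 0)).
    change (plus ?a ?b) with (a + b). rewrite rsum_indicator by exact Hi.
    rewrite rsum_lin_comb. fold S0. apply Req_le. ring. }
  unfold quadform. rewrite csum_Re.
  eapply Rle_trans; [|apply rsum_le; exact row].
  rewrite rsum_lin_comb. fold S0.
  replace (_ + _) with ((delta - INR (S n) * eps) * S0) by field.
  apply Rmult_le_pos; lra.
Qed.

(** The rescaling is a congruence by an invertible diagonal matrix, undone by dividing each [x i] by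
    [sqrt (i!)]. *)
Lemma psd_fockm n A : (forall x, 0 <= Re (quadform n (fockm A) x)) ->
  forall x, 0 <= Re (quadform n A x).
Proof.
  intros H x. specialize (H (fun i => / RtoC (sqrt_fact i) * x i)%C).
  replace (quadform n A x) with (quadform n (fockm A) (fun i => / RtoC (sqrt_fact i) * x i)%C);
    [exact H|].
  apply sum_n_ext. intros i. apply sum_n_ext. intros j. unfold fockm.
  rewrite Cmult_conj, <- RtoC_inv, Cconj_RtoC, RtoC_inv by (pose proof (sqrt_fact_pos i); lra).
  Ceq. field. split; apply sqrt_factC_neq.
Qed.

(** * Vanishing entries of positive matrices *)

Lemma quadform_delta N A i j (a b : C) :
  (i <= N)%nat -> (j <= N)%nat ->
  quadform N A (fun k => (a * (if Nat.eqb k i then RtoC 1 else RtoC 0) +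
                          b * (if Nat.eqb k j then RtoC 1 else RtoC 0))%C) =
  (Cconj a * a * A i i + Cconj a * b * A i j + Cconj b * a * A j i + Cconj b * b * A j j)%C.
Proof.
  intros Hi Hj.
  assert (one : forall f m, (m <= N)%nat ->
    sum_n (fun k => ((if Nat.eqb k m then RtoC 1 else RtoC 0) * f k)%C) N = f m).
  { intros f m Hm. rewrite (csum_single _ m N Hm).
    - rewrite Nat.eqb_refl. cring.
    - intros k _ Hk. rewrite (proj2 (Nat.eqb_neq k m) Hk). ring. }
  assert (two : forall a b f,
    sum_n (fun k => ((a * (if Nat.eqb k i then RtoC 1 else RtoC 0) +
                     b * (if Nat.eqb k j then RtoC 1 else RtoC 0)) * f k)%C) N =
    (a * f i + b * f j)%C).
  { intros a' b' f. rewrite <- (one f i Hi), <- (one f j Hj), <- !csum_scal, <- csum_plus.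
    apply sum_n_ext. intros k. cring. }
  unfold quadform.
  rewrite (sum_n_ext _ (fun p =>
    ((Cconj a * (if Nat.eqb p i then RtoC 1 else RtoC 0) +
      Cconj b * (if Nat.eqb p j then RtoC 1 else RtoC 0)) *
     (a * A p i + b * A p j))%C)).
  - rewrite two. cring.
  - intros p. rewrite <- two, <- csum_scal. apply sum_n_ext. intros k.
    rewrite Cplus_conj, !Cmult_conj.
    replace (Cconj (if Nat.eqb p i then RtoC 1 else RtoC 0))
      with (if Nat.eqb p i then RtoC 1 else RtoC 0) by (destruct (Nat.eqb p i); now rewrite Cconj_RtoC).
    replace (Cconj (if Nat.eqb p j then RtoC 1 else RtoC 0))
      with (if Nat.eqb p j then RtoC 1 else RtoC 0) by (destruct (Nat.eqb p j); now rewrite Cconj_RtoC).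
    cring.
Qed.

Lemma psd_pair A i j (a b : C) : psd A ->
  0 <= Re (Cconj a * a * A i i + Cconj a * b * A i j + Cconj b * a * A j i + Cconj b * b * A j j)%C.
Proof. intros H. rewrite <- (quadform_delta (i + j)) by lia. apply H. Qed.

Lemma psd_diag A i : psd A -> 0 <= Re (A i i).
Proof.
  intros H. pose proof (psd_pair A i i (RtoC 1) (RtoC 0) H) as E.
  rewrite !Cconj_RtoC in E.
  match type of E with 0 <= Re ?z => replace z with (A i i) in E by ring end. exact E.
Qed.

(** On [-M A_ij e_i + e_j] the form equals [A_jj - 2 M |A_ij|^2], which becomes negative for large
    [M] unless [A_ij] is zero. *)
Lemma psd_null_row A i j : hermitian A -> psd A -> A i i = RtoC 0 -> A i j = RtoC 0.
Proof.
  intros Hh Hp H0.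
  assert (HM : forall M : R, 0 <= Re (A j j) - 2 * M * Cmod (A i j) ^ 2).
  { intros M. pose proof (psd_pair A i j (- RtoC M * A i j)%C (RtoC 1) Hp) as E.
    rewrite H0, (Hh i j), Cmult_conj, Copp_conj, !Cconj_RtoC in E.
    match type of E with 0 <= Re ?z =>
      replace z with (A j j + RtoC (- (2 * M)) * (A i j * Cconj (A i j)))%C in E end.
    - rewrite <- Cmod2_conj, <- RtoC_mult in E.
      change (Re (?a + ?b)%C) with (Re a + Re b) in E. simpl Re in E. unfold Re in *. lra.
    - rewrite RtoC_opp, RtoC_mult. ring. }
  (* This [M] makes the value exactly -1. *)
  apply Cmod_eq_0. pose proof (HM ((Re (A j j) + 1) / (2 * Cmod (A i j) ^ 2))) as E.
  destruct (Req_dec (Cmod (A i j)) 0) as [|Hne]; [assumption|exfalso].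
  match type of E with 0 <= ?z => replace z with (-1) in E; [lra|] end.
  field. exact Hne.
Qed.

(** Beyond [n] two non-negative diagonal entries have a positive combination equal to zero, so each
    vanishes and takes its row and column with it. *)
Lemma component_supported n X Y Z lam :
  supported n X -> hermitian Y -> psd Y -> psd Z -> 0 < lam < 1 ->
  (forall i j, X i j = comb lam Y Z i j) -> supported n Y.
Proof.
  intros HX HY PY PZ Hl E i j Hij.
  assert (D : forall k, (n < k)%nat -> Y k k = RtoC 0).
  { intros k Hk. pose proof (E k k) as Ek. rewrite HX in Ek by lia.
    pose proof (psd_diag Y k PY). pose proof (psd_diag Z k PZ).
    apply (f_equal Re) in Ek. unfold comb in Ek.
    change (Re (?a + ?b)%C) with (Re a + Re b) in Ek. rewrite !Re_RtoC_mult in Ek. simpl in Ek.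
    rewrite (hermitian_diag Y k HY). f_equal. nra. }
  destruct Hij as [Hi|Hj].
  - apply psd_null_row; auto.
  - rewrite HY, psd_null_row by auto. apply Cconj_RtoC.
Qed.

Lemma component_supported_r n X Y Z lam :
  supported n X -> hermitian Z -> psd Y -> psd Z -> 0 < lam < 1 ->
  (forall i j, X i j = comb lam Y Z i j) -> supported n Z.
Proof.
  intros HX HZ PY PZ Hl E. apply (component_supported n X Z Y (1 - lam)); try assumption; [lra|].
  intros i j. rewrite E. unfold comb. replace (1 - (1 - lam)) with lam by ring. ring.
Qed.

(** The contribution of [k = n - i] to the rescaled diagonal entry [(i, i)] of V_t A, where [b] is
    the rescaled entry [(n, n)] of [A]. *)
Definition vertigo_top (n : nat) (t b : R) (i : nat) : R :=
  t ^ i * ((t - 1) ^ (n - i) / INR (fact (n - i))) * b.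

Lemma fockm_bound n A : supported n A ->
  exists K, 0 <= K /\ forall i j, Cmod (fockm A i j) <= K.
Proof.
  intros HA. exists (sum_n (fun i => sum_n (fun j => Cmod (fockm A i j)) n) n).
  assert (P : forall i, 0 <= sum_n (fun j => Cmod (fockm A i j)) n).
  { intros i. rewrite sum_n_Reals. apply cond_pos_sum. intros. apply Cmod_ge_0. }
  assert (P0 : 0 <= sum_n (fun i => sum_n (fun j => Cmod (fockm A i j)) n) n).
  { rewrite sum_n_Reals. now apply cond_pos_sum. }
  split; [exact P0|]. intros i j.
  destruct (Nat.le_gt_cases i n) as [Hi|Hi]; [destruct (Nat.le_gt_cases j n) as [Hj|Hj]|].
  - eapply Rle_trans; [|apply (rsum_ge_term (fun i => sum_n (fun j => Cmod (fockm A i j)) n) i n P Hi)].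
    apply (rsum_ge_term (fun j => Cmod (fockm A i j))); [|exact Hj]. intros. apply Cmod_ge_0.
  - rewrite (fockm_supported n A HA), Cmod_0 by lia. exact P0.
  - rewrite (fockm_supported n A HA), Cmod_0 by lia. exact P0.
Qed.

(* In [t^((i+j)/2) (t-1)^k A(i+k,j+k)] the exponent [(i+j)/2 + k] reaches [n]
   only for [i = j = n-k]; every other term loses at least a factor [sqrt t]. *)
Lemma vertigo_near_diagonal n A t K b i j :
  supported n A -> 1 <= t -> (forall p q, Cmod (fockm A p q) <= K) ->
  fockm A n n = RtoC b -> (i <= n)%nat -> (j <= n)%nat ->
  sqrt t * Cmod (fockm (vertigo t A) i j -
     (if Nat.eqb i j then RtoC (vertigo_top n t b i) else RtoC 0))
  <= INR (S n) * (K * t ^ n).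
Proof.
  intros HA Ht HK Hb Hi Hj.
  assert (Hr : 1 <= sqrt t) by (rewrite <- sqrt_1; now apply sqrt_le_1_alt).
  assert (Kpos : 0 <= K) by (eapply Rle_trans; [apply (Cmod_ge_0 (fockm A i j))|apply HK]).
  (* The leading term is spread over the summation index, so that the difference can be bounded term
     by term. *)
  set (top := fun k => if andb (Nat.eqb i j) (Nat.eqb k (n - i))
     then RtoC (vertigo_top n t b i) else RtoC 0).
  assert (Etop : (if Nat.eqb i j then RtoC (vertigo_top n t b i) else RtoC 0) = sum_n top n).
  { rewrite (csum_single top (n - i)); [|lia|].
    - unfold top. rewrite Nat.eqb_refl. now destruct (Nat.eqb i j).
    - intros k _ Hk. unfold top. rewrite (proj2 (Nat.eqb_neq k (n - i)) Hk).
      now destruct (Nat.eqb i j). }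
  rewrite Etop, (fockm_vertigo n), <- csum_scal by exact HA.
  replace (sum_n _ n - sum_n top n)%C with (sum_n (fun k =>
    (RtoC (sqrt t ^ (i + j)) * (exp_coeff (t - 1) k * fockm A (i + k)%nat (j + k)%nat) + - (1) * top k)%C) n).
  2:{ rewrite csum_plus, (csum_scal (- (1))). cring. }
  eapply Rle_trans; [apply Rmult_le_compat_l; [lra|apply csum_Cmod]|].
  rewrite <- (sum_n_mult_l (K := R_Ring)), <- sum_n_const.
  apply rsum_le. intros k Hk. change (mult ?a ?b) with (a * b).
  assert (small : sqrt t * Cmod (RtoC 0) <= K * t ^ n).
  { rewrite Cmod_0, Rmult_0_r. apply Rmult_le_pos; [exact Kpos|]. apply pow_le. lra. }
  (* With the weight bounded by [t^k], the power of [sqrt t] is at most [i + j + 2k]; the hypothesis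
     leaves room for the prefactor [sqrt t] below [2n]. *)
  assert (lossy : (S (i + j + (k + k)) <= n + n)%nat ->
    sqrt t * Cmod (RtoC (sqrt t ^ (i + j)) * (exp_coeff (t - 1) k * fockm A (i + k)%nat (j + k)%nat))
    <= K * t ^ n).
  { intros Hlt. unfold exp_coeff. rewrite !Cmod_mult, !Cmod_R.
    assert (0 <= (t - 1) ^ k) by (apply pow_le; lra).
    pose proof (fact_pos k) as Hf.
    rewrite !Rabs_pos_eq;
      [|apply Rmult_le_pos; [assumption|left; now apply Rinv_0_lt_compat]|apply pow_le; lra].
    assert (Hw : (t - 1) ^ k / INR (fact k) <= sqrt t ^ (k + k)).
    { rewrite sqrt_pow2k by lra. apply Rle_trans with ((t - 1) ^ k).
      - apply Rle_div_l; [exact Hf|]. rewrite <- (Rmult_1_r ((t - 1) ^ k)) at 1.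
        apply Rmult_le_compat_l; [assumption|]. apply (le_INR 1). apply lt_O_fact.
      - apply pow_incr. lra. }
    apply Rle_trans with (sqrt t ^ (n + n) * K); [|rewrite sqrt_pow2k by lra; lra].
    apply Rle_trans with (sqrt t * sqrt t ^ (i + j) * sqrt t ^ (k + k) * K).
    - rewrite <- !Rmult_assoc, (Rmult_assoc _ _ (Cmod _)).
      rewrite (Rmult_assoc _ _ K). apply Rmult_le_compat_l.
      + apply Rmult_le_pos; [lra|apply pow_le; lra].
      + apply Rmult_le_compat; [|apply Cmod_ge_0|exact Hw|apply HK].
        apply Rmult_le_pos; [assumption|left; now apply Rinv_0_lt_compat].
    - apply Rmult_le_compat_r; [exact Kpos|].
      rewrite tech_pow_Rmult, <- pow_add. apply Rle_pow; [exact Hr|]. exact Hlt. }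
  destruct (Nat.eq_dec i j) as [Eij|Eij]; [destruct (Nat.eq_dec (i + k) n) as [Hin|Hin]|].
  { subst j. unfold top.
    replace k with (n - i)%nat by lia. rewrite !Nat.eqb_refl. cbn [andb].
    replace (i + (n - i))%nat with n by lia. rewrite Hb, sqrt_pow2k by lra.
    unfold exp_coeff, vertigo_top. rewrite <- RtoC_opp, <- !RtoC_mult, <- RtoC_plus.
    match goal with |- _ * Cmod (RtoC ?z) <= _ => replace z with 0 by ring end.
    exact small. }
  all: assert (Et : top k = RtoC 0) by
    (unfold top; try rewrite (proj2 (Nat.eqb_neq i j) Eij);
     try rewrite (proj2 (Nat.eqb_neq k (n - i))) by lia;
     rewrite ?Bool.andb_false_r; reflexivity).
  all: rewrite Et, Cmult_0_r, Cplus_0_r.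
  all: destruct (Nat.le_gt_cases (i + k) n) as [H1|H1];
    [destruct (Nat.le_gt_cases (j + k) n) as [H2|H2]|];
    [|rewrite (fockm_supported n A HA), !Cmult_0_r by lia; exact small
     |rewrite (fockm_supported n A HA), !Cmult_0_r by lia; exact small].
  all: apply lossy; lia.
Qed.

Lemma vertigo_eventually_positive n A :
  supported n A -> hermitian A -> 0 < Re (A n n) ->
  exists t0, 0 < t0 /\ forall t, t0 <= t ->
    psd (vertigo t A) /\ 0 < Re (op_trace (vertigo t A)).
Proof.
  intros HA Hh Hpos. destruct (fockm_bound n A HA) as [K [K0 HK]].
  set (b := sqrt_fact n * sqrt_fact n * Re (A n n)).
  assert (Hb : fockm A n n = RtoC b).
  { unfold fockm, b. rewrite (hermitian_diag A n Hh) at 1. now rewrite <- !RtoC_mult. }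
  assert (b0 : 0 < b).
  { unfold b. rewrite sqrt_fact_sqr. apply Rmult_lt_0_compat; [apply fact_pos|exact Hpos]. }
  (* For [t >= 2] one has [t - 1 >= t/2], so each [vertigo_top] is at least [dl t^n]. *)
  set (dl := b / (2 ^ n * INR (fact n))).
  assert (dl0 : 0 < dl).
  { apply Rdiv_lt_0_compat; [exact b0|]. apply Rmult_lt_0_compat; [apply pow_lt; lra|apply fact_pos]. }
  set (m := INR (S n)). assert (m0 : 1 <= m) by (apply (le_INR 1); lia).
  (* Dominance needs [m (m K) < dl sqrt t]. The [+ 1] makes this strict, as positivity of the trace
     requires; the threshold [2 + r0^2] yields both [t >= 2] and [sqrt t >= r0]. *)
  set (r0 := (m * (m * K) + 1) / dl).
  assert (Hr0 : 0 < r0) by (apply Rdiv_lt_0_compat; [|exact dl0]; nra).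
  exists (2 + r0 ^ 2). split; [nra|]. intros t Ht.
  assert (Ht2 : 2 <= t) by nra.
  assert (Hr : r0 <= sqrt t).
  { rewrite <- (sqrt_pow2 r0) by lra. apply sqrt_le_1_alt. lra. }
  assert (Hr1 : 0 < sqrt t) by lra.
  assert (tn : 0 < t ^ n) by (apply pow_lt; lra).
  set (eps := m * (K * t ^ n) / sqrt t).
  assert (He : forall i j, (i <= n)%nat -> (j <= n)%nat ->
     Cmod (fockm (vertigo t A) i j -
       (if Nat.eqb i j then RtoC (vertigo_top n t b i) else RtoC 0)) <= eps).
  { intros i j Hi Hj. unfold eps. apply Rle_div_r; [exact Hr1|]. rewrite Rmult_comm.
    apply vertigo_near_diagonal; try assumption. lra. }
  assert (Hd : forall i, (i <= n)%nat -> dl * t ^ n <= vertigo_top n t b i).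
  { intros i Hi. unfold vertigo_top, dl.
    assert (E : (t / 2) ^ (n - i) <= (t - 1) ^ (n - i)) by (apply pow_incr; lra).
    unfold Rdiv in E. rewrite Rpow_mult_distr, pow_inv in E.
    replace (t ^ n) with (t ^ i * t ^ (n - i)) by (rewrite <- pow_add; f_equal; lia).
    assert (0 < t ^ i) by (apply pow_lt; lra).
    assert (0 < t ^ (n - i)) by (apply pow_lt; lra).
    assert (F1 : / 2 ^ n <= / 2 ^ (n - i)).
    { apply Rinv_le_contravar; [apply pow_lt; lra|]. apply Rle_pow; [lra|lia]. }
    assert (F2 : / INR (fact n) <= / INR (fact (n - i))).
    { apply Rinv_le_contravar; [apply fact_pos|]. apply le_INR, fact_le. lia. }
    assert (0 < / 2 ^ n) by (apply Rinv_0_lt_compat, pow_lt; lra).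
    assert (0 < / INR (fact n)) by (apply Rinv_0_lt_compat, fact_pos).
    apply Rle_trans with (t ^ i * (t ^ (n - i) * / 2 ^ n * / INR (fact n)) * b).
    { apply Req_le. field. split; [pose proof (fact_pos n); lra|]. apply pow_nonzero. lra. }
    apply Rmult_le_compat_r; [lra|]. apply Rmult_le_compat_l; [lra|].
    apply Rmult_le_compat; [apply Rmult_le_pos; lra|lra| |exact F2].
    eapply Rle_trans; [|exact E]. apply Rmult_le_compat_l; lra. }
  assert (Hde : m * eps < dl * t ^ n).
  { unfold eps. replace (m * (m * (K * t ^ n) / sqrt t)) with (m * (m * K) * t ^ n / sqrt t)
      by (field; lra).
    apply Rlt_div_l; [exact Hr1|].
    assert (m * (m * K) + 1 = r0 * dl) by (unfold r0; field; lra).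
    assert (r0 * dl <= sqrt t * dl) by (apply Rmult_le_compat_r; lra).
    replace (dl * t ^ n * sqrt t) with ((sqrt t * dl) * t ^ n) by ring.
    apply Rmult_lt_compat_r; lra. }
  split.
  - apply (supported_psd n); [now apply vertigo_supported|]. apply psd_fockm. intros x.
    apply (dominant_diagonal_quadform n _ (vertigo_top n t b) (dl * t ^ n) eps x Hd He).
    fold m. lra.
  - assert (Hdiag : forall i, (i <= n)%nat -> 0 < Re (vertigo t A i i)).
    { intros i Hi. specialize (He i i Hi Hi). specialize (Hd i Hi). rewrite Nat.eqb_refl in He.
      pose proof (Rle_trans _ _ _ (re_le_Cmod _) He) as Habs.
      assert (E : Re (fockm (vertigo t A) i i) = sqrt_fact i * sqrt_fact i * Re (vertigo t A i i)).
      { unfold fockm. now rewrite <- RtoC_mult, Re_RtoC_mult. }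
      change (Re (?x - RtoC ?y)%C) with (Re x - y) in Habs. rewrite E, sqrt_fact_sqr in Habs.
      apply Rabs_le_between in Habs.
      assert (0 <= eps) by (unfold eps; apply Rle_div_r; [exact Hr1|]; rewrite Rmult_0_l;
        apply Rmult_le_pos; [lra|]; apply Rmult_le_pos; lra).
      apply (Rmult_lt_reg_l (INR (fact i))); [apply fact_pos|]. rewrite Rmult_0_r. nra. }
    rewrite (trace_supported n), csum_Re by now apply vertigo_supported.
    apply Rlt_le_trans with (sum_n (fun k => if Nat.eqb n k then Re (vertigo t A n n) else 0) n).
    + rewrite rsum_indicator by lia. apply Hdiag. lia.
    + apply rsum_le. intros k Hk. destruct (Nat.eqb_spec n k) as [<-|]; [lra|].
      left. now apply Hdiag.
Qed.

(** * Extremality of the normalised image *)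

Lemma psd_scale c A : 0 <= c -> psd A -> psd (fun i j => (RtoC c * A i j)%C).
Proof.
  intros Hc HA N x.
  replace (sum_n _ N) with (RtoC c * quadform N A x)%C.
  - rewrite Re_RtoC_mult. apply Rmult_le_pos; [exact Hc|apply HA].
  - unfold quadform. rewrite <- csum_scal. apply sum_n_ext. intros i.
    rewrite <- csum_scal. apply sum_n_ext. intros j. cring.
Qed.

Theorem theorem3 (n : nat) (A : op) :
  extr (An_plus n) A -> 0 < Re (A n n) ->
  exists t0 : R, 0 < t0 /\
    forall t : R, t0 <= t ->
      op_trace (vertigo t A) <> 0%C /\
      extr (Dn_plus n) (vertigo_norm t A) /\
      extr D_plus (vertigo_norm t A).
Proof.
  intros HA Hpos. pose proof (proj1 HA) as [[HhA HqA] [HsA HwA]].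
  destruct (vertigo_eventually_positive n A HsA HhA Hpos) as [t0 [Ht0 H]].
  exists t0. split; [exact Ht0|]. intros t Ht. destruct (H t Ht) as [Hpsd HT]. clear H.
  assert (t_pos : 0 < t) by lra.
  pose proof (vertigo_supported n t A HsA) as HsV.
  pose proof (vertigo_hermitian n t A HsA HhA) as HhV.
  pose proof (hermitian_trace n _ HsV HhV) as ET.
  set (T := Re (op_trace (vertigo t A))) in *.
  assert (T_neq : RtoC T <> RtoC 0) by (apply RtoC_neq; lra).
  assert (EX : vertigo_norm t A = (fun i j => (RtoC (/ T) * vertigo t A i j)%C)).
  { apply functional_extensionality; intros i. apply functional_extensionality; intros j.
    unfold vertigo_norm. rewrite ET, RtoC_inv by lra. field. exact T_neq. }
  assert (EL : vertigo_norm t A = lin_comb (/ T) 0 (vertigo t A) (vertigo t A)).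
  { rewrite EX. apply functional_extensionality; intros i. apply functional_extensionality; intros j.
    unfold lin_comb. ring. }
  assert (HsX : supported n (vertigo_norm t A)) by (rewrite EL; now apply lin_comb_supported).
  assert (HX : Dn_plus n (vertigo_norm t A)).
  { split; [|exact HsX]. split; [split|].
    - apply (supported_quasi_state n); [exact HsX|rewrite EL; now apply lin_comb_hermitian|].
      rewrite EL, (trace_lin_comb n), ET, <- !RtoC_mult, <- RtoC_plus by assumption.
      apply f_equal. field. lra.
    - rewrite EX. apply psd_scale; [left; now apply Rinv_0_lt_compat|exact Hpsd].
    - intros al. rewrite EL, (Re_wigner_lin_comb n) by assumption.
      rewrite (wigner_vertigo n), Re_RtoC_mult by (assumption || lra).
      assert (0 <= / T * (exp (2 * (t - 1) * Cmod al ^ 2) * Re (wigner A (RtoC (sqrt t) * al)%C))).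
      { apply Rmult_le_pos; [left; now apply Rinv_0_lt_compat|].
        apply Rmult_le_pos; [left; apply exp_pos|apply HwA]. }
      lra. }
  (* Each component is proportional to V_t A, and unit trace fixes the factor as [/ T]. Treating one
     component suffices, since the other follows by exchanging the weights. *)
  assert (comp : forall Y Z lam, Dn_plus n Y -> Dn_plus n Z -> 0 < lam < 1 ->
    (forall i j, vertigo_norm t A i j = comb lam Y Z i j) ->
    forall i j, Y i j = vertigo_norm t A i j).
  { intros Y Z lam [[[HqY HpY] HwY] HsY] [[[HqZ HpZ] HwZ] HsZ] Hlam E.
    destruct (vertigo_component n A t T lam Y Z) as [y Hy]; try assumption.
    - exact (proj1 HqY).
    - intros i j. specialize (E i j). rewrite EX in E. unfold comb in E. unfold lin_comb.
      rewrite !RtoC_mult, <- !Cmult_assoc, <- Cmult_plus_distr_l, <- E, RtoC_inv by lra.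
      field. exact T_neq.
    - pose proof (quasi_state_trace n Y HsY HqY) as HtY.
      assert (EY : Y = lin_comb y 0 (vertigo t A) (vertigo t A)).
      { apply functional_extensionality; intros i. apply functional_extensionality; intros j.
        rewrite Hy. unfold lin_comb. ring. }
      rewrite EY, (trace_lin_comb n), ET, <- !RtoC_mult, <- RtoC_plus in HtY by assumption.
      apply RtoC_inj in HtY.
      replace y with (/ T) in EY; [now rewrite EL, EY|].
      apply (Rmult_eq_reg_r T); [|lra]. rewrite Rinv_l; lra. }
  assert (ext : forall Y Z lam, Dn_plus n Y -> Dn_plus n Z -> 0 < lam < 1 ->
    (forall i j, vertigo_norm t A i j = comb lam Y Z i j) -> forall i j, Y i j = Z i j).
  { intros Y Z lam HY HZ Hlam E i j.
    rewrite (comp Y Z lam HY HZ Hlam E). symmetry.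
    apply (comp Z Y (1 - lam) HZ HY); [lra|]. intros p q. rewrite E. unfold comb.
    replace (1 - (1 - lam)) with lam by ring. ring. }
  split; [rewrite ET; exact T_neq|]. split; [split; [exact HX|exact ext]|].
  split; [exact (proj1 HX)|]. intros Y Z lam HY HZ Hlam E.
  pose proof HY as [[[HhY _] HpY] _]. pose proof HZ as [[[HhZ _] HpZ] _].
  apply (ext Y Z lam); [split; [exact HY|]|split; [exact HZ|]|exact Hlam|exact E].
  - exact (component_supported n _ Y Z lam HsX HhY HpY HpZ Hlam E).
  - exact (component_supported_r n _ Y Z lam HsX HhZ HpY HpZ Hlam E).
Qed.
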